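(* Suppose that the Nash equilibrium $\boldsymbol x^*=\mathcal O(\pi)$ reached by the followers is unique, and that the KKT matrix $$M=\begin{bmatrix}\nabla_{\boldsymbol x}F & G^\top & A^\top\\ \mathrm{Diag}(\boldsymbol\lambda^* )G & \mathrm{Diag}(G\boldsymbol x^*-h) & 0\\ A&0&0\end{bmatrix}$$ is invertible. Then the implicit function theorem holds, and the derivative $\frac{d\boldsymbol x^*}{d\pi}$ of the followers' Nash equilibrium with respect to the leader's strategy can be uniquely determined by the linear system $$M\begin{bmatrix}\frac{d\boldsymbol x^*}{d\pi}\\[2pt] \frac{d\boldsymbol\lambda^*}{d\pi}\\[2pt] \frac{d\boldsymbol\nu^*}{d\pi}\end{bmatrix}=\begin{bmatrix}-\nabla_\pi F\\0\\0\end{bmatrix}.$$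
   Context: Setting: one leader and $n$ followers. The leader announces a strategy $\pi\in\Pi$. Given $\pi$, the followers play a simultaneous game: follower $i$ chooses $x_i\in\mathcal X_i=\{x_i\mid A_ix_i=b_i,\ G_ix_i\le h_i\}$ and minimizes his objective $f_i(x_i,x_{-i},\pi)$, where $x_{-i}$ denotes the other followers' actions. The constraint data $A_i,b_i,G_i,h_i$ are constant, and each $f_i$ is twice differentiable ($f_i\in C^2$). A Nash equilibrium at $\pi$ is $\boldsymbol x^*=(x_1^*,\dots,x_n^* )$ with $x_i^*\in\mathcal X_i$ and $f_i(x_i^*,x_{-i}^*,\pi)\le f_i(x_i,x_{-i}^*,\pi)$ for all $i$ and all $x_i\in\mathcal X_i$. It is assumed to be unique and is written $\boldsymbol x^*=\mathcal O(\pi)$, where $\mathcal O$ is the equilibrium oracle returning the followers' equilibrium given the leader's strategy. The KKT conditions of follower $i$ at the equilibrium, with dual variables $\lambda_i^*$ (for $G_ix_i\le h_i$) and $\nu_i^*$ (for $A_ix_i=b_i$), are $$\nabla_{x_i} f_i(x_i^*,x_{-i}^*,\pi)+G_i^\top\lambda_i^*+A_i^\top\nu_i^*=0,\qquad \mathrm{Diag}(\lambda_i^* )(G_ix_i^*-h_i)=0,\qquad A_ix_i^*=b_i.$$ The linear system in the claim is the total derivative, with respect to $\pi$, of these conditions concatenated over all followers. Notation: $F=[(\nabla_{x_1}f_1)^\top,\dots,(\nabla_{x_n}f_n)^\top]^\top$ is a column vector, with Jacobians $\nabla_{\boldsymbol x}F$ and $\nabla_\pi F$; $G=\mathrm{Diag}(G_1,\dots,G_n)$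 and $A=\mathrm{Diag}(A_1,\dots,A_n)$ are block diagonal; $h$, $\boldsymbol\lambda^*$, $\boldsymbol\nu^*$ are the concatenations of the $h_i$, $\lambda_i^*$, $\nu_i^*$; for a vector $u$, $\mathrm{Diag}(u)$ is the diagonal matrix with diagonal $u$. All entries of $M$ and $\nabla_\pi F$ are evaluated at $(\boldsymbol x^*,\boldsymbol\lambda^*,\boldsymbol\nu^*,\pi)$.
   Formalization: That the derivative found is that of the oracle O itself is claimed only if O is bounded near π or each f_i is convex in x_i on X_i (otherwise O can be discontinuous at π); π is taken in the interior of Π. *)

(* Defs.v *)
From HB Require Import structures.
From mathcomp Require Import all_boot all_order all_algebra.
From mathcomp Require Import all_classical all_reals all_analysis.

Set Implicit Arguments.
Unset Strict Implicit.
Unset Printing Implicit Defensive.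

Import Order.TTheory GRing.Theory Num.Theory.
Import numFieldNormedType.Exports.

Local Open Scope classical_set_scope.
Local Open Scope ring_scope.

Section calculus.
Context {R : realType}.

(* Column-vector convention: entry (i, j) is the j-th partial derivative of the
   i-th component, the transpose of the library's jacobian on row vectors. *)
Definition jac (a b : nat) (g : 'cV[R]_a -> 'cV[R]_b) (y : 'cV[R]_a) :
    'M[R]_(b, a) :=
  \matrix_(i, j) ('D_(delta_mx j 0) g y) i 0.

Definition grad (a : nat) (g : 'cV[R]_a -> R) (y : 'cV[R]_a) : 'cV[R]_a :=
  \col_j 'D_(delta_mx j 0) g y.

(* In finite dimension, continuity of all directional derivatives is
   continuity of the differential. *)
Definition C1_on (V W : normedModType R) (U : set V) (g : V -> W) : Prop :=
  forall z, U z ->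
    differentiable g z /\ forall v, {for z, continuous ('D_v g)}.

Definition C2_on (V W : normedModType R) (U : set V) (g : V -> W) : Prop :=
  C1_on U g /\ forall v, C1_on U ('D_v g).

(* Diag(B_1, ..., B_n) for rectangular blocks (\mxdiag only takes square ones).
   conform_mx is only a cast from 'M_(p i, q i) to 'M_(p i, q j), used when
   i = j. *)
Definition block_diag (n : nat) (p q : 'I_n -> nat)
    (B : forall i, 'M[R]_(p i, q i)) : 'M[R]_(\sum_i p i, \sum_i q i) :=
  \mxblock_(i, j) (if i == j then conform_mx 0 (B i) else 0).

Definition Diag (m : nat) (u : 'cV[R]_m) : 'M[R]_m := diag_mx u^T.

End calculus.

(* Follower i acts in R^(dimX i) under neqc i equality and nineq i inequality
   constraints; the leader's strategies live in R^p.  Joint actions and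
   multipliers are concatenated column vectors, with i-th block submxcol _ i.
   In obj, the joint action comes first and the leader's strategy second. *)
Record game (R : realType) (n p : nat) := Game {
  dimX : 'I_n -> nat;
  nineq : 'I_n -> nat;
  neqc : 'I_n -> nat;
  Gi : forall i, 'M[R]_(nineq i, dimX i);
  hi : forall i, 'cV[R]_(nineq i);
  Ai : forall i, 'M[R]_(neqc i, dimX i);
  bi : forall i, 'cV[R]_(neqc i);
  obj : 'I_n -> 'cV[R]_(\sum_i dimX i) -> 'cV[R]_p -> R
}.

Arguments obj {R n p} g i x pi : rename.

Section stackelberg.
Context {R : realType} {n p : nat} (g : game R n p).

Local Notation action := 'cV[R]_(\sum_i dimX g i).
Local Notation imult := 'cV[R]_(\sum_i nineq g i).
Local Notation emult := 'cV[R]_(\sum_i neqc g i).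
Local Notation leader := 'cV[R]_p.

Definition feasible (i : 'I_n) : set 'cV[R]_(dimX g i) :=
  [set y | Ai g i *m y = bi g i /\
           forall k, (Gi g i *m y) k 0 <= hi g i k 0].

(* (y, x_{-i}) *)
Definition deviate (i : 'I_n) (x : action) (y : 'cV[R]_(dimX g i)) : action :=
  \mxcol_j @dfwith _ (fun k => 'cV[R]_(dimX g k)) (submxcol x) i y j.

Arguments feasible : clear implicits.
Arguments deviate : clear implicits.

Definition is_NE (pi : leader) (x : action) : Prop :=
  forall i, feasible i (submxcol x i) /\
    forall y : 'cV[R]_(dimX g i), feasible i y ->
      obj g i x pi <= obj g i (deviate i x y) pi.

Definition equilibrium_oracle (Pi : set leader) (O : leader -> action) : Prop :=
  forall pi, Pi pi ->
    is_NE pi (O pi) /\ forall x, is_NE pi x -> x = O pi.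

Definition smooth_game (Pi : set leader) : Prop :=
  forall i, C2_on (setT `*` Pi°)
    ((fun z => obj g i z.1 z.2) : action * leader -> R).

(* Convexity of f_i in x_i over X_i, which makes KKT points with nonnegative
   inequality multipliers Nash equilibria. *)
Definition own_convex (Pi : set leader) : Prop :=
  forall i pi x (y z : 'cV[R]_(dimX g i)) (t : R),
    Pi pi -> (forall j, feasible j (submxcol x j)) ->
    feasible i y -> feasible i z -> 0 <= t <= 1 ->
    obj g i (deviate i x (t *: y + (1 - t) *: z)) pi <=
      t * obj g i (deviate i x y) pi + (1 - t) * obj g i (deviate i x z) pi.

(* nabla_{x_i} f_i (x, pi) *)
Definition own_grad (i : 'I_n) (x : action) (pi : leader) : 'cV[R]_(dimX g i) :=
  grad (fun y : 'cV[R]_(dimX g i) => obj g i (deviate i x y) pi) (submxcol x i).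

Arguments own_grad : clear implicits.

Definition Fmap (x : action) (pi : leader) : action :=
  \mxcol_i own_grad i x pi.

(* lam >= 0 is not part of the conditions; at a Nash equilibrium it follows when
   KKT_mx is invertible. *)
Definition KKT (x : action) (lam : imult) (nu : emult) (pi : leader) : Prop :=
  forall i,
    [/\ own_grad i x pi + (Gi g i)^T *m submxcol lam i
          + (Ai g i)^T *m submxcol nu i = 0,
        Diag (submxcol lam i) *m (Gi g i *m submxcol x i - hi g i) = 0 &
        Ai g i *m submxcol x i = bi g i].

Definition Gmx := block_diag (Gi g).
Definition Amx := block_diag (Ai g).
Definition hvec : imult := \mxcol_i hi g i.

Definition KKT_mx (x : action) (lam : imult) (pi : leader) :=
  block_mx (jac (fun y => Fmap y pi) x) (row_mx Gmx^T Amx^T)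
    (col_mx (Diag lam *m Gmx) Amx)
    (block_mx (Diag (Gmx *m x - hvec)) 0 0 0).

(* X, L, N stand for the derivatives of x, lambda, nu with respect to pi. *)
Definition sensitivity_system (x : action) (lam : imult) (pi : leader)
    (X : 'M[R]_(\sum_i dimX g i, p)) (L : 'M[R]_(\sum_i nineq g i, p))
    (N : 'M[R]_(\sum_i neqc g i, p)) : Prop :=
  KKT_mx x lam pi *m col_mx X (col_mx L N) =
    col_mx (- jac (Fmap x) pi) (col_mx 0 0).

End stackelberg.

Arguments feasible {R n p g} i _.
Arguments deviate {R n p g} i x y.
Arguments own_grad {R n p g} i x pi.

(* Main.v *)
Require Import Defs.
From HB Require Import structures.
From mathcomp Require Import all_boot all_order all_algebra.
From mathcomp Require Import all_classical all_reals all_analysis.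
From mathcomp Require Import ring lra.

(** The implicit function theorem is obtained from Banach's fixed point theorem
    applied to e |-> e - M^-1 Phi (e, q), and is used with Phi the KKT map.

    Invertibility of the KKT matrix M forces strict complementarity (otherwise M
    has a zero row) and lets one solve for a direction that leaves exactly one
    active constraint, so the inequality multipliers of a Nash equilibrium are
    nonnegative.  Under convexity, the perturbed KKT points keep these signs and
    are therefore equilibria.  If instead O is only bounded near pi, compactness
    and uniqueness make O continuous at pi; each O q has unsigned multipliers,
    because the own gradient vanishes on the kernel of the active constraints,
    and M determines them from the gradients, so that (O q, l, v) lies in the
    neighbourhood where the KKT point is unique. *)

Set Implicit Arguments.
Unset Strict Implicit.
Unset Printing Implicit Defensive.

Import Order.TTheory GRing.Theory Num.Theory.
Import numFieldNormedType.Exports.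

Local Open Scope classical_set_scope.
Local Open Scope ring_scope.

(** * Continuously differentiable maps *)

(** The KKT conditions enter as equations only, so the branch given by the implicit function theorem
    need not consist of equilibria, and uniqueness of the equilibrium at each [q] does not by itself
    keep [O q] near [O pi] as [q] tends to [pi]. The two alternatives in the last conclusion close
    this gap from opposite sides: convexity makes the points of the branch equilibria, hence equal
    to [O q], while boundedness makes the values [O q] points of the branch. Signs of multipliers
    matter only for the first. Regularity is stated one direction at a time, so the uniform
    estimates behind the contraction come from expanding over the finite basis of the [e] space. The
    parameter space stays an arbitrary normed space: continuity and differentiability in the
    parameter follow from lower bounds on the partial derivative in [e]. The instance below supplies
    the completeness that Banach's theorem asks for. *)

HB.instance Definition _ (R : realType) m n :=
  Uniform_isComplete.Build 'M[R]_(m, n) (@mx_complete R m n).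

Section matrix_norm.
Context {R : realType}.

Lemma ler_coord_norm m n (A : 'M[R]_(m, n)) i j : `|A i j| <= `|A|.
Proof.
by rewrite [leRHS]/Num.Def.normr/= mx_normrE; apply: (le_bigmax _ _ (i, j)).
Qed.

Lemma mx_norm_le m n (A : 'M[R]_(m, n)) c :
  0 <= c -> (forall i j, `|A i j| <= c) -> `|A| <= c.
Proof.
move=> c0 Ac; rewrite [leLHS]/Num.Def.normr/= mx_normrE.
by apply: bigmax_le => // -[i j] _; exact: Ac.
Qed.

(** Expanding [A] over the elementary matrices bounds the norm of [f A] by [|A|] times the sum of
    the norms of their images. *)
Lemma linear_mx_continuous m n (W : normedModType R)
  (f : {linear 'M[R]_(m, n) -> W}) : continuous f.
Proof.
apply/bounded_linear_continuous/linear_boundedP.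
near=> r => A; rewrite {1}(matrix_sum_delta A) linear_sum.
apply: (@le_trans _ _ ((\sum_i \sum_j `|f (delta_mx i j)|) * `|A|)); last first.
  by rewrite ler_wpM2r//; near: r; exact: nbhs_pinfty_ge.
rewrite mulr_suml; apply: le_trans (ler_norm_sum _ _ _) _.
apply: ler_sum => i _; rewrite linear_sum mulr_suml.
apply: le_trans (ler_norm_sum _ _ _) _; apply: ler_sum => j _.
by rewrite linearZ normrZ mulrC ler_wpM2l// ler_coord_norm.
Unshelve. all: by end_near. Qed.

Lemma prod_normE (V W : normedModType R) (z : V * W) :
  `|z| = Num.max `|z.1| `|z.2|.
Proof. by []. Qed.

End matrix_norm.

Section C1_theory.
Context {R : realType}.
Implicit Types V W X : normedModType R.

(** Working criterion for all closure properties below. A formula for the derivative is known only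
    on [U]; openness turns it into an equality near each point, which is what continuity of ['D_v g]
    at that point sees. *)
Lemma C1_on_derive V W (U : set V) (g : V -> W) (D : V -> V -> W) :
  open U -> (forall z, U z -> differentiable g z) ->
  (forall v z, U z -> 'D_v g z = D v z) ->
  (forall v z, U z -> {for z, continuous (D v)}) -> C1_on U g.
Proof.
move=> oU dg DE cD z Uz; split=> [|v]; first exact: dg.
have DzE : {near z, 'D_v g =1 D v}.
  by near=> y; apply: DE; near: y; exact: open_nbhs_nbhs.
rewrite /prop_for /continuous_at (nbhs_singleton DzE).
apply: cvg_trans (cD v z Uz); apply: near_eq_cvg.
by apply: filterS DzE => y ->.
Unshelve. all: by end_near. Qed.

Lemma C1_on_sub V W (U U' : set V) (g : V -> W) :
  U `<=` U' -> C1_on U' g -> C1_on U g.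
Proof. by move=> UU' Cg z /UU'/Cg. Qed.

Lemma C1_on_continuous V W (U : set V) (g : V -> W) z :
  C1_on U g -> U z -> {for z, continuous g}.
Proof. by move=> Cg /Cg[/differentiable_continuous]. Qed.

Lemma C1_on_linear V W (U : set V) (f : {linear V -> W}) :
  open U -> continuous f -> C1_on U f.
Proof.
move=> oU cf; apply: (@C1_on_derive _ _ _ _ (fun v _ => f v)) => //.
- by move=> z _; exact: linear_differentiable.
- move=> v z _; rewrite deriveE; last exact: linear_differentiable.
  by rewrite diff_lin.
- by move=> v z _; exact: cvg_cst.
Qed.

Lemma C1_on_cst V W (U : set V) (c : W) : open U -> C1_on U (fun=> c).
Proof.
move=> oU; apply: (@C1_on_derive _ _ _ _ (fun _ _ => 0)) => //.
- by move=> v z _; exact: derive_cst.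
- by move=> v z _; exact: cvg_cst.
Qed.

Lemma C1_onD V W (U : set V) (f g : V -> W) :
  open U -> C1_on U f -> C1_on U g -> C1_on U (fun z => f z + g z).
Proof.
move=> oU Cf Cg.
apply: (@C1_on_derive _ _ _ _ (fun v z => 'D_v f z + 'D_v g z)) => //.
- by move=> z Uz; apply: differentiableD; [exact: (Cf z Uz).1 | exact: (Cg z Uz).1].
- by move=> v z Uz; rewrite deriveD//; apply: diff_derivable;
    [exact: (Cf z Uz).1 | exact: (Cg z Uz).1].
- by move=> v z Uz; apply: cvgD; [exact: (Cf z Uz).2 | exact: (Cg z Uz).2].
Qed.

Lemma C1_onM V (U : set V) (f g : V -> R) :
  open U -> C1_on U f -> C1_on U g -> C1_on U (fun z => f z * g z).
Proof.
move=> oU Cf Cg.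
apply: (@C1_on_derive _ _ _ _ (fun v z => f z * 'D_v g z + g z * 'D_v f z)) => //.
- by move=> z Uz; apply: differentiableM; [exact: (Cf z Uz).1 | exact: (Cg z Uz).1].
- by move=> v z Uz; rewrite deriveM//; apply: diff_derivable;
    [exact: (Cf z Uz).1 | exact: (Cg z Uz).1].
- move=> v z Uz; apply: cvgD; apply: cvgM; try exact: C1_on_continuous Uz.
  + exact: (Cg z Uz).2.
  + exact: (Cf z Uz).2.
Qed.

Lemma derive_linear_comp V W X (L : {linear W -> X}) (g : V -> W) z v :
  continuous L -> differentiable g z -> 'D_v (L \o g) z = L ('D_v g z).
Proof.
move=> cL dg; have dL := linear_differentiable (g z) cL.
rewrite !deriveE//; last exact: differentiable_comp.
by rewrite diff_comp//= diff_lin.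
Qed.

Lemma C1_on_linear_comp V W X (U : set V) (L : {linear W -> X}) (g : V -> W) :
  open U -> continuous L -> C1_on U g -> C1_on U (L \o g).
Proof.
move=> oU cL Cg.
apply: (@C1_on_derive _ _ _ _ (fun v z => L ('D_v g z))) => //.
- move=> z Uz; apply: differentiable_comp; first exact: (Cg z Uz).1.
  exact: linear_differentiable.
- by move=> v z Uz; rewrite derive_linear_comp//; exact: (Cg z Uz).1.
- move=> v z Uz; apply: (continuous_comp _ (cL _)).
  exact: (Cg z Uz).2.
Qed.

(** Both difference quotients are the same function of [h]. The equality thus holds at every point
    and can be used as an equality of functions in [C1_on_comp_linear]. *)
Lemma derive_comp_linear V W X (L : {linear V -> W}) (g : W -> X) z v :
  'D_v (g \o L) z = 'D_(L v) g (L z).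
Proof.
rewrite /derive; set f1 := (X in lim (X @ _)); set f2 := (X in _ = lim (X @ _)).
suff -> : f1 = f2 by [].
by apply/funext => h; rewrite /f1 /f2 /= linearP.
Qed.

Lemma C1_on_comp_linear V W X (U : set W) (L : {linear V -> W}) (g : W -> X) :
  continuous L -> C1_on U g -> C1_on (L @^-1` U) (g \o L).
Proof.
move=> cL Cg z Uz; split=> [|v].
  apply: differentiable_comp; first exact: linear_differentiable.
  exact: (Cg _ Uz).1.
have -> : 'D_v (g \o L) = 'D_(L v) g \o L.
  by apply/funext => y; exact: derive_comp_linear.
by apply: (continuous_comp (cL z)); exact: (Cg _ Uz).2.
Qed.

Lemma differentiable_mx V m n (g : V -> 'M[R]_(m, n)) z :
  (forall i j, differentiable (fun y => g y i j) z) -> differentiable g z.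
Proof.
move=> dg.
have -> : g = \sum_i \sum_j (fun y => g y i j *: delta_mx i j).
  apply/funext => y; rewrite fct_sumE [LHS]matrix_sum_delta.
  by apply: eq_bigr => i _; rewrite fct_sumE.
apply: differentiable_sum => i; apply: differentiable_sum => j.
exact: differentiableZl.
Qed.

Lemma derive_coord V m n (g : V -> 'M[R]_(m, n)) z v i j :
  differentiable g z -> ('D_v g z) i j = 'D_v (fun y => g y i j) z.
Proof.
by move=> dg; rewrite derive_mx ?mxE//; exact: diff_derivable.
Qed.

Lemma C1_on_mx V m n (U : set V) (g : V -> 'M[R]_(m, n)) :
  open U -> (forall i j, C1_on U (fun y => g y i j)) -> C1_on U g.
Proof.
move=> oU Cg.
have dg z : U z -> differentiable g z.
  by move=> Uz; apply: differentiable_mx => i j; exact: (Cg i j z Uz).1.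
apply: (@C1_on_derive _ _ _ _
  (fun v z => \matrix_(i, j) 'D_v (fun y => g y i j) z)) => //.
  by move=> v z Uz; apply/matrixP => i j; rewrite mxE derive_coord//; exact: dg.
move=> v z Uz; apply/cvgrPdist_le => e e0.
have H : \forall y \near z, forall i j,
    `|'D_v (fun y => g y i j) z - 'D_v (fun y => g y i j) y| <= e.
  apply: filter_forall => i; apply: filter_forall => j.
  by have /cvgrPdist_le := (Cg i j z Uz).2 v; exact.
by apply: filterS H => y H; apply: mx_norm_le (ltW e0) _ => i j; rewrite !mxE.
Qed.

Lemma C1_on_coord V m n (U : set V) (g : V -> 'M[R]_(m, n)) i j :
  open U -> C1_on U g -> C1_on U (fun y => g y i j).
Proof.
move=> oU Cg.
apply: (@C1_on_derive _ _ _ _ (fun v z => ('D_v g z) i j)) => //.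
- move=> z Uz; apply: (@differentiable_comp _ _ _ _ g (fun A => A i j)).
    exact: (Cg z Uz).1.
  exact: differentiable_coord.
- by move=> v z Uz; rewrite derive_coord//; exact: (Cg z Uz).1.
- move=> v z Uz.
  apply: (@continuous_comp _ _ _ ('D_v g) (fun A : 'M[R]_(m, n) => A i j)).
    exact: (Cg z Uz).2.
  exact: coord_continuous.
Qed.

End C1_theory.

(** * The implicit function theorem *)

Section implicit_function.
Context {R : realType}.

Lemma derive_pairl_expand (N : nat) (P W : normedModType R)
  (Phi : 'cV[R]_N * P -> W) z (u : 'cV[R]_N) :
  differentiable Phi z ->
  'D_((u, 0 : P)) Phi z = \sum_j u j 0 *: 'D_((delta_mx j 0, 0 : P)) Phi z.
Proof.
move=> dPhi; rewrite deriveE//.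
have -> : (u, 0 : P) = \sum_j u j 0 *: (delta_mx j 0 : 'cV[R]_N, 0 : P).
  rewrite [in LHS](matrix_sum_delta u).
  under eq_bigr => i _ do rewrite big_ord1.
  rewrite (big_morph (fun x : 'cV_N => (x, 0 : P)) (id1 := 0) (op1 := +%R))//.
    by apply: eq_bigr => i _; apply: injective_projections; rewrite //= scaler0.
  by move=> x y; apply: injective_projections; rewrite //= addr0.
rewrite linear_sum; apply: eq_bigr => j _.
by rewrite linearZ deriveE.
Qed.

(** Continuity is available one direction at a time; asking it of the [N] basis directions within
    [e / N.+1] makes the estimate uniform in [u]. The successor keeps the denominator nonzero when
    [N] is 0. *)
Lemma derive_pairl_close (N : nat) (P W : normedModType R)
  (S : set ('cV[R]_N * P)) (Phi : 'cV[R]_N * P -> W) z0 e :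
  open S -> S z0 -> C1_on S Phi -> 0 < e ->
  \forall z \near z0, forall u : 'cV[R]_N,
    `|'D_((u, 0 : P)) Phi z0 - 'D_((u, 0 : P)) Phi z| <= e * `|u|.
Proof.
move=> oS Sz0 CPhi e0.
have N0 : 0 < e / N.+1%:R by rewrite divr_gt0.
have : \forall z \near z0, forall j : 'I_N,
    `|'D_((delta_mx j 0, 0 : P)) Phi z0 - 'D_((delta_mx j 0, 0 : P)) Phi z|
      <= e / N.+1%:R.
  apply: (@filter_forall _ _ _ (nbhs z0)) => j.
  by have /cvgrPdist_le := (CPhi z0 Sz0).2 (delta_mx j 0, 0); exact.
have : \forall z \near z0, S z by exact: open_nbhs_nbhs.
apply: filterS2 => z Sz H u.
rewrite !derive_pairl_expand; [|exact: (CPhi _ Sz).1|exact: (CPhi _ Sz0).1].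
rewrite -sumrB (le_trans (ler_norm_sum _ _ _))//.
apply: (@le_trans _ _ (\sum_(j < N) e / N.+1%:R * `|u|)).
  apply: ler_sum => j _; rewrite -scalerBr normrZ mulrC.
  by rewrite ler_pM// ler_coord_norm.
rewrite sumr_const card_ord -[leLHS]mulr_natr.
apply: (@le_trans _ _ (e / N.+1%:R * N%:R * `|u|)); first by rewrite mulrAC.
apply: ler_wpM2r; first exact: normr_ge0.
by rewrite mulrAC ler_pdivrMr ?ltr0n// ler_wpM2l ?ler_nat// ltW.
Qed.

(** The norm is the largest coordinate, so the scalar mean value theorem applies to each coordinate
    along the segment, with an intermediate point that may depend on the coordinate. *)
Lemma mean_value_le (V : normedModType R) m (g : V -> 'cV[R]_m) a b c :
  (forall t : R, 0 <= t <= 1 -> differentiable g (a + t *: (b - a)) /\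
     `|'D_(b - a) g (a + t *: (b - a))| <= c) ->
  `|g b - g a| <= c.
Proof.
move=> H.
have c0 : 0 <= c.
  by have [|_] := H 0; [rewrite lexx ler01 | exact: le_trans].
apply: mx_norm_le => // i j; rewrite ord1 {j}.
pose p (t : R) := a + t *: (b - a).
pose phi (t : R) : R := g (p t) i 0.
have dphi (t : R) : 0 <= t <= 1 ->
    is_derive t 1 phi (('D_(b - a) g (p t)) i 0).
  move=> t01; have [dg _] := H t t01.
  have dp : is_diff t p ( *:%R^~ (b - a)).
    have -> : p = cst a + ( *:%R^~ (b - a)) by [].
    apply: is_diff_eq.
    by apply/funext => s; rewrite /= fctE add0r.
  have dgi : differentiable (fun y => g y i 0) (p t).
    apply: (@differentiable_comp _ _ _ _ g (fun A : 'cV_m => A i 0)) => //.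
    exact: differentiable_coord.
  have dphi : differentiable phi t.
    exact: (@differentiable_comp _ _ _ _ p (fun y => g y i 0 : R)).
  apply: DeriveDef; first exact: diff_derivable.
  rewrite deriveE// (_ : phi = (fun y => g y i 0 : R) \o p)//.
  rewrite diff_comp//= derive_coord// [in RHS]deriveE//.
  by rewrite diff_val scale1r.
have [||t t01] := @MVT R phi (fun t => ('D_(b - a) g (p t)) i 0) 0 1 ltr01.
- move=> t; rewrite in_itv/= => /andP[t0 t1].
  by apply: dphi; rewrite !ltW.
- apply: continuous_in_subspaceT => t.
  rewrite inE/= in_itv/= => /dphi[/derivable1_diffP dt _].
  exact: differentiable_continuous.
have p1 : p 1 = b by rewrite /p scale1r addrC subrK.
have p0 : p 0 = a by rewrite /p scale0r addr0.
rewrite /phi p1 p0 subr0 mulr1 => E.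
rewrite !mxE E; apply: le_trans (ler_coord_norm _ _ _) _.
apply: (H t _).2.
by move: t01; rewrite in_itv/= => /andP[t0 t1]; rewrite !ltW.
Qed.


Lemma for_continuous_pair (T V W : topologicalType) (f : T -> V) (g : T -> W) z :
  {for z, continuous f} -> {for z, continuous g} ->
  {for z, continuous (fun y => (f y, g y))}.
Proof. exact: cvg_pair. Qed.

(** [kermx] is a left kernel, hence the passage to the transpose: the rows of the kernel of [J^T]
    are the transposed vectors that [J] kills. *)
Lemma unitmx_inj N (J : 'M[R]_N) :
  (forall u : 'cV[R]_N, J *m u = 0 -> u = 0) -> J \in unitmx.
Proof.
move=> J0; rewrite -unitmx_tr -row_free_unit -kermx_eq0; apply/eqP.
apply/row_matrixP => i; rewrite row0; apply: trmx_inj; rewrite trmx0.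
apply: J0; apply: trmx_inj.
by rewrite trmx_mul trmxK trmx0 -row_mul mulmx_ker row0.
Qed.

(** * Contraction argument for a map whose partial derivative in [e] is close to the identity *)

Section newton.
Context {N : nat} {P : normedModType R}.
Context {S : set ('cV[R]_N * P)} {Phi : 'cV[R]_N * P -> 'cV[R]_N}.
Context {e0 : 'cV[R]_N} {r : R} {U : set P}.
Context (C1Phi : C1_on S Phi) (r0 : 0 < r) (oU : open U).
Context (inS : forall e q, `|e - e0| <= r -> U q -> S (e, q)).
Context (near_id : forall e q u, `|e - e0| <= r -> U q ->
  `|u - 'D_((u, 0 : P)) Phi (e, q)| <= 2^-1 * `|u|).
Context (small : forall q, U q -> `|Phi (e0, q)| <= r / 4).

Lemma newton_lipschitz q e e' : U q -> `|e - e0| <= r -> `|e' - e0| <= r ->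
  `|(e - Phi (e, q)) - (e' - Phi (e', q))| <= 2^-1 * `|e - e'|.
Proof.
move=> Uq er e'r.
pose g (z : 'cV[R]_N * P) := z.1 - Phi z.
have := @mean_value_le _ _ g (e', q) (e, q) (2^-1 * `|e - e'|); apply => t.
move=> /andP[t0 t1].
have -> : (e, q) - (e', q) = (e - e', 0) :> 'cV[R]_N * P.
  by apply: injective_projections; rewrite //= subrr.
have -> : (e', q) + t *: (e - e', 0) = (e' + t *: (e - e'), q)
    :> 'cV[R]_N * P.
  by apply: injective_projections; rewrite //= scaler0 addr0.
have tr : `|e' + t *: (e - e') - e0| <= r.
  have -> : e' + t *: (e - e') - e0 = (1 - t) *: (e' - e0) + t *: (e - e0).
    by apply/matrixP => i j; rewrite !mxE; ring.
  apply: le_trans (ler_normD _ _) _; rewrite !normrZ !ger0_norm ?subr_ge0//.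
  have : (1 - t) * `|e' - e0| <= (1 - t) * r by rewrite ler_wpM2l// subr_ge0.
  have : t * `|e - e0| <= t * r by rewrite ler_wpM2l.
  lra.
have Sz := inS tr Uq; have dPhi := (C1Phi Sz).1.
have dfst : differentiable (fst : 'cV[R]_N * P -> 'cV[R]_N)
    (e' + t *: (e - e'), q).
  by apply: linear_differentiable => z; exact: cvg_fst.
split; first exact: differentiableB.
rewrite [X in `|X|](_ : _ = (e - e') - 'D_((e - e', 0 : P)) Phi
  (e' + t *: (e - e'), q)); first exact: near_id.
rewrite deriveB; [|exact: diff_derivable..].
congr (_ - _); rewrite deriveE// diff_lin// => z; exact: cvg_fst.
Qed.

(** [e - e'] is the increment of [e - Phi (e, q)] plus the increment of [Phi]; the former is at most
    half of [|e - e'|] and is absorbed on the left. Uniqueness and continuity of the solution both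
    follow from this bound. *)
Lemma newton_dist q e e' : U q -> `|e - e0| <= r -> `|e' - e0| <= r ->
  `|e - e'| <= 2 * `|Phi (e, q) - Phi (e', q)|.
Proof.
move=> Uq er e'r; have := newton_lipschitz Uq er e'r.
set d := (X in `|X| <= _) => H.
have -> : e - e' = d + (Phi (e, q) - Phi (e', q)).
  by rewrite /d; apply/matrixP => i j; rewrite !mxE; ring.
have := ler_normD d (Phi (e, q) - Phi (e', q)).
have -> : d + (Phi (e, q) - Phi (e', q)) = e - e'.
  by rewrite /d; apply/matrixP => i j; rewrite !mxE; ring.
lra.
Qed.

(** Infinitesimal form of [newton_dist]: the partial derivative in [e] is bounded below on the whole
    ball, hence injective there and not only at the base point. *)
Lemma derive_dist q e u : U q -> `|e - e0| <= r ->
  `|u| <= 2 * `|'D_((u, 0 : P)) Phi (e, q)|.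
Proof.
move=> Uq er; have := near_id u er Uq; set D := 'D__ _ _.
have := ler_normD (u - D) D; rewrite subrK.
lra.
Qed.

Lemma newton_zero q : U q -> exists e, `|e - e0| < r /\ Phi (e, q) = 0.
Proof.
move=> Uq.
pose B := closed_ball_ (fun x : 'cV[R]_N => `|x|) e0 r.
have Be0 : B e0 by rewrite /B /closed_ball_/= subrr normr0 ltW.
(* 3/4 is the contraction factor 1/2 plus the 1/4 of [small]. Being below 1, it also places the
   fixed point strictly inside the ball. *)
have homo34 e : B e -> `|e - Phi (e, q) - e0| <= 3 / 4 * r.
  rewrite /B /closed_ball_/= distrC => er.
  have := newton_lipschitz Uq er (_ : `|e0 - e0| <= r).
  rewrite subrr normr0 (ltW r0) => /(_ isT).
  set d := (X in `|X| <= _) => H.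
  have -> : e - Phi (e, q) - e0 = d - Phi (e0, q).
    by rewrite /d; apply/matrixP => i j; rewrite !mxE; ring.
  have := ler_normB d (Phi (e0, q)); have := small Uq; lra.
have homo : {homo (fun e => e - Phi (e, q)) : e / B e >-> B e}.
  move=> e /homo34; rewrite /B /closed_ball_/= [in X in _ -> X]distrC; move: r0; lra.
have [|||e Be eE] := @banach_fixed_point R 'cV[R]_N B (mkfun homo).
- exists (2^-1 : R)%:nng; split => /=; first by lra.
  move=> [e e'] [/=]; rewrite /B /closed_ball_/= => er e'r.
  by apply: newton_lipschitz; rewrite // distrC.
- exact: closed_closed_ball_.
- by exists e0.
have Phie : Phi (e, q) = 0.
  by move/eqP: eE; rewrite /mkfun -subr_eq0 opprB addrC subrK => /eqP.
exists e; split => //; have := homo34 _ Be; rewrite Phie subr0.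
by move: r0; lra.
Qed.

Context {eh : P -> 'cV[R]_N}.
Context (ehP : forall q, U q -> `|eh q - e0| < r /\ Phi (eh q, q) = 0).

Lemma implicit_unique q e : U q -> `|e - e0| <= r -> Phi (e, q) = 0 -> e = eh q.
Proof.
move=> Uq er Pe; have [/ltW ehr Peh] := ehP Uq.
have := newton_dist Uq er ehr; rewrite Pe Peh subr0 normr0 mulr0.
by rewrite normr_le0 subr_eq0 => /eqP.
Qed.

(** [eh q] and [eh x] are compared at the same parameter [x]: their distance is at most twice
    [|Phi (eh q, x)|], which tends to [|Phi (eh q, q)| = 0]. *)
Lemma implicit_continuous q : U q -> {for q, continuous eh}.
Proof.
move=> Uq; have [/ltW ehr Peh] := ehP Uq.
have cPhi : Phi (eh q, x) @[x --> q] --> (0 : 'cV[R]_N).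
  rewrite -Peh; apply: (@continuous_comp _ _ _ (fun x => (eh q, x)) Phi).
    by apply: for_continuous_pair; [exact: cvg_cst | exact: cvg_id].
  exact: C1_on_continuous C1Phi (inS ehr Uq).
apply/cvgrPdist_le => eps eps0; near=> x.
have Ux : U x by near: x; exact: open_nbhs_nbhs.
have [/ltW exr Pex] := ehP Ux.
have := newton_dist Ux ehr exr; rewrite Pex subr0.
have : `|0 - Phi (eh q, x)| <= eps / 2.
  by near: x; move/cvgrPdist_le: cPhi; apply; rewrite divr_gt0.
rewrite sub0r normrN; lra.
Unshelve. all: by end_near. Qed.

(** The candidate [L] solves the linearised equation. With [d] the remainder of [eh], the
    differential of [Phi] takes the same value on [(d, 0)] as on the increment of [(eh q, q)], and
    there it is minus the first-order remainder of [Phi], because [Phi] vanishes at both ends.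
    [derive_dist] converts this smallness into smallness of [d]. *)
Lemma implicit_differentiable q : U q -> differentiable eh q /\
  forall v, 'd Phi (eh q, q) ('d eh q v, v) = 0.
Proof.
move=> Uq; have [/ltW ehr Peh] := ehP Uq.
set z := (eh q, q); have dPhi : differentiable Phi z by exact: (C1Phi (inS ehr Uq)).1.
pose J : 'M[R]_N := \matrix_(i, j) ('d Phi z (delta_mx j 0, 0 : P)) i 0.
have JE u : J *m u = 'd Phi z (u, 0).
  rewrite -deriveE// derive_pairl_expand//; apply/matrixP => i j.
  rewrite ord1 !mxE summxE; apply: eq_bigr => k _.
  by rewrite !mxE deriveE// mulrC.
have uJ : J \in unitmx.
  apply: unitmx_inj => u; rewrite JE -deriveE// => D0.
  have := derive_dist u Uq ehr; rewrite D0 normr0 mulr0 normr_le0.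
  by move/eqP.
pose L (v : P) := - (invmx J *m 'd Phi z (0, v)).
have pairD (u : 'cV[R]_N) (v : P) : (u, v) = (u, 0) + (0, v).
  by apply: injective_projections; rewrite //= ?addr0 ?add0r.
have LE v : 'd Phi z (L v, v) = 0.
  by rewrite pairD linearD -JE mulmxN mulKVmx// addNr.
have linL : linear L.
  move=> a u v; rewrite /L.
  have -> : (0, a *: u + v) = a *: (0, u) + (0, v) :> 'cV[R]_N * P.
    by apply: injective_projections; rewrite //= scaler0 addr0.
  by rewrite linearP mulmxDr -scalemxAr opprD scalerN.
pose LM := GRing.isLinear.Build _ _ _ _ _ linL.
pose gL : {linear P -> 'cV[R]_N} := HB.pack L LM.
have cL : continuous gL.
  move=> v; apply: cvgN.
  apply: (@continuous_comp _ _ _ (fun v => 'd Phi z (0, v)) (mulmx (invmx J))).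
    apply: (@continuous_comp _ _ _ (fun v : P => (0 : 'cV[R]_N, v)) ('d Phi z)).
      by apply: for_continuous_pair; [exact: cvg_cst | exact: cvg_id].
    exact: (diff_continuous dPhi).
  exact: linear_mx_continuous.
have [K K0 LK] := linear_lipschitz cL.
have oL : eh \o shift q = cst (eh q) + gL +o_ 0 id.
  apply/eqaddoP => eps eps0.
  (* The estimate will read [|d| <= 2 * (4^-1 * |d| + c * (K + 1) * |v|)]. The first bound on [c]
     lets half of [|d|] be absorbed; the second makes the resulting [4 * c * (K + 1) * |v|] at most
     [eps * |v|]. *)
  pose c := Num.min (4^-1) (eps / (4 * (K + 1))).
  have K1 : 0 < 4 * (K + 1) by lra.
  have c0 : 0 < c by rewrite lt_min invr_gt0 ltr0n/= divr_gt0.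
  have c4 : c <= 4^-1 by rewrite ge_min lexx.
  have ceps : c * (4 * (K + 1)) <= eps.
    by rewrite -ler_pdivlMr// ge_min lexx orbT.
  have /diff_locally/eqaddoP/(_ c c0) := dPhi.
  have cw : (eh (v + q) - eh q, v) @[v --> (0 : P)] --> ((0, 0) : 'cV[R]_N * P).
    have cq : eh (v + q) @[v --> (0 : P)] --> eh q.
      have := @implicit_continuous q Uq; rewrite /prop_for/continuous_at => H.
      have sq : v + q @[v --> (0 : P)] --> 0 + q.
        exact: cvgD cvg_id (cvg_cst q).
      by rewrite add0r in sq; exact: cvg_comp sq H.
    have cB : eh (v + q) - eh q @[v --> (0 : P)] --> (0 : 'cV[R]_N).
      by rewrite -(subrr (eh q)); apply: cvgB => //; exact: cvg_cst.
    exact: cvg_pair cB cvg_id.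
  move=> /cw near0; near=> v.
  have Uv : U (v + q).
    near: v; have sq : v + q @[v --> (0 : P)] --> 0 + q.
      exact: cvgD cvg_id (cvg_cst q).
    by rewrite add0r in sq; apply: sq; exact: open_nbhs_nbhs.
  have [_ Pev] := ehP Uv.
  pose d := eh (v + q) - eh q - gL v.
  rewrite [X in `|X| <= _](_ : _ = d); last first.
    by rewrite /d !fctE /= opprD addrA.
  have wle : `|'d Phi z (eh (v + q) - eh q, v)| <=
      c * `|(eh (v + q) - eh q, v) : 'cV[R]_N * P|.
    have : `|(Phi \o shift z - (cst (Phi z) + 'd Phi z))
      (eh (v + q) - eh q, v)| <= c * `|(eh (v + q) - eh q, v) : 'cV[R]_N * P|.
      by near: v; exact: near0.
    rewrite !fctE/= Peh add0r.
    have -> : (eh (v + q) - eh q, v) + z = (eh (v + q), v + q).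
      by apply: injective_projections; rewrite //= subrK.
    by rewrite Pev sub0r normrN.
  have dE : 'd Phi z (d, 0) = 'd Phi z (eh (v + q) - eh q, v).
    have -> : (d, 0) = (eh (v + q) - eh q, v) - (gL v, v) :> 'cV[R]_N * P.
      by apply: injective_projections; rewrite //= subrr.
    by rewrite linearB LE subr0.
  have := derive_dist d Uq ehr; rewrite deriveE// dE.
  have eh_le : `|eh (v + q) - eh q| <= `|d| + K * `|v|.
    have -> : eh (v + q) - eh q = d + gL v by rewrite /d subrK.
    by apply: le_trans (ler_normD _ _) _; rewrite lerD2l.
  have max_le : `|(eh (v + q) - eh q, v) : 'cV[R]_N * P| <=
      `|d| + (K + 1) * `|v|.
    rewrite prod_normE ge_max /=.
    have := normr_ge0 d; have := normr_ge0 v.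
    have : 0 <= K * `|v| by rewrite mulr_ge0// ltW.
    by move=> *; apply/andP; split; lra.
  have cmax : c * `|(eh (v + q) - eh q, v) : 'cV[R]_N * P| <=
      4^-1 * `|d| + c * (K + 1) * `|v|.
    apply: (@le_trans _ _ (c * (`|d| + (K + 1) * `|v|))).
      by rewrite ler_wpM2l// ltW.
    by rewrite mulrDr mulrA lerD2r ler_wpM2r.
  have : c * (4 * (K + 1)) * `|v| <= eps * `|v| by rewrite ler_wpM2r.
  rewrite /= => ? ?; lra.
split.
  by apply/diff_locallyP; rewrite (diff_unique cL oL).
by move=> v; rewrite (diff_unique cL oL).
Unshelve. all: by end_near. Qed.

Lemma implicit_derive q v : U q -> 'D_(('D_v eh q, v)) Phi (eh q, q) = 0.
Proof.
move=> Uq; have [/ltW ehr _] := ehP Uq; have [deh E] := implicit_differentiable Uq.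
by rewrite deriveE ?deriveE//; exact: (C1Phi (inS ehr Uq)).1.
Qed.

(** No formula with an inverse is differentiated. At [(eh x, x)] the derivative of [Phi] along
    [('D_v eh x, v)] vanishes, so [derive_dist] bounds [w - 'D_v eh x] by twice the derivative along
    [(w, v)], which tends to its value 0 at [q]. *)
Lemma implicit_C1 : C1_on U eh.
Proof.
move=> q Uq; split=> [|v]; first exact: (implicit_differentiable Uq).1.
set w := 'D_v eh q.
have [/ltW ehr _] := ehP Uq.
have cD : 'D_((w, v)) Phi (eh x, x) @[x --> q] --> (0 : 'cV[R]_N).
  rewrite -(implicit_derive v Uq) -/w.
  apply: (@continuous_comp _ _ _ (fun x => (eh x, x)) ('D_((w, v)) Phi)).
    by apply: for_continuous_pair; [exact: implicit_continuous | exact: cvg_id].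
  exact: (C1Phi (inS ehr Uq)).2.
apply/cvgrPdist_le => eps eps0; near=> x.
have Ux : U x by near: x; exact: open_nbhs_nbhs.
have [/ltW exr _] := ehP Ux.
have dPhi := (C1Phi (inS exr Ux)).1.
have := derive_dist (w - 'D_v eh x) Ux exr.
have -> : (w - 'D_v eh x, 0) = (w, v) - ('D_v eh x, v) :> 'cV[R]_N * P.
  by apply: injective_projections; rewrite //= subrr.
rewrite (deriveE _ dPhi) linearB -!(deriveE _ dPhi) implicit_derive// subr0.
have : `|0 - 'D_((w, v)) Phi (eh x, x)| <= eps / 2.
  by near: x; move/cvgrPdist_le: cD; apply; rewrite divr_gt0.
rewrite sub0r normrN /=; lra.
Unshelve. all: by end_near. Qed.


End newton.

Lemma implicit_function N (P : normedModType R) (S : set ('cV[R]_N * P))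
    (Phi : 'cV[R]_N * P -> 'cV[R]_N) (e0 : 'cV[R]_N) (q0 : P) (M : 'M[R]_N) :
  open S -> S (e0, q0) -> C1_on S Phi -> Phi (e0, q0) = 0 ->
  M \in unitmx -> (forall u, 'D_((u, 0 : P)) Phi (e0, q0) = M *m u) ->
  exists (eh : P -> 'cV[R]_N) (U : set P) (W : set 'cV[R]_N),
    [/\ open_nbhs q0 U, open_nbhs e0 W,
       (forall q, U q -> [/\ S (eh q, q), W (eh q) &
          forall e, W e -> (Phi (e, q) = 0 <-> e = eh q)]),
       eh q0 = e0 &
       C1_on U eh /\
       forall q v, U q -> 'D_(('D_v eh q, v)) Phi (eh q, q) = 0].
Proof.
move=> oS Sz0 CPhi0 Phi0 uM DM.
(* Preconditioning makes the partial derivative in [e] the identity at [(e0, q0)] without changing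
   the zeros, so [derive_pairl_close] with constant 1/2 becomes the hypothesis [near_id]. *)
pose Psi := mulmx (invmx M) \o Phi.
have cM : continuous (mulmx (invmx M) : 'cV[R]_N -> 'cV[R]_N).
  exact: linear_mx_continuous.
have CPsi : C1_on S Psi by exact: C1_on_linear_comp.
have DPsi z v : S z -> 'D_v Psi z = invmx M *m 'D_v Phi z.
  by move=> Sz; rewrite derive_linear_comp//; exact: (CPhi0 _ Sz).1.
have Psi_eq0 z : Psi z = 0 <-> Phi z = 0.
  rewrite /Psi/=; split => [H|->]; last by rewrite mulmx0.
  by rewrite -(mulKVmx uM (Phi z)) H mulmx0.
have half : 0 < 2^-1 :> R by lra.
have near_S : \forall z \near (e0, q0), S z by exact: open_nbhs_nbhs.
have [[A B] /= [nA nB] AB] : nbhs (e0, q0) [set z | S z /\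
    forall u : 'cV[R]_N, `|'D_((u, 0 : P)) Psi (e0, q0) -
       'D_((u, 0 : P)) Psi z| <= 2^-1 * `|u|].
  apply: filterS2 near_S (derive_pairl_close oS Sz0 CPsi half).
  by move=> z.
have [r r0 rA] : exists2 r, 0 < r & forall e, `|e - e0| <= r -> A e.
  have /nbhs_normP[r /= r0 rA] := nA.
  (* Halving puts the closed ball, on which the contraction acts, inside the open ball contained in
     [A]. *)
  exists (r / 2); first exact: divr_gt0.
  by move=> e er; apply: rA; rewrite /ball_/= distrC; move: r0; lra.
pose U : set P := [set q | B q /\ `|Psi (e0, q)| <= r / 4]°.
have UP q : U q -> B q /\ `|Psi (e0, q)| <= r / 4.
  exact: interior_subset.
have Psi0 : Psi (e0, q0) = 0 by apply/Psi_eq0.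
have oU : open U by exact: open_interior.
have Uq0 : U q0.
  have cPsi : Psi (e0, x) @[x --> q0] --> (0 : 'cV[R]_N).
    rewrite -Psi0; apply: (@continuous_comp _ _ _ (fun x => (e0, x)) Psi).
      by apply: for_continuous_pair; [exact: cvg_cst | exact: cvg_id].
    exact: C1_on_continuous CPsi Sz0.
  have r4 : 0 < r / 4 by rewrite divr_gt0.
  move/cvgrPdist_le: cPsi => /(_ _ r4).
  apply: filterS2 nB => x Bx; by rewrite sub0r normrN.
have inS e q : `|e - e0| <= r -> U q -> S (e, q).
  by move=> er /UP[Bq _]; have [] := AB (e, q) (conj (rA _ er) Bq).
have near_id e q u : `|e - e0| <= r -> U q ->
    `|u - 'D_((u, 0 : P)) Psi (e, q)| <= 2^-1 * `|u|.
  move=> er /UP[Bq _]; have [_] := AB (e, q) (conj (rA _ er) Bq).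
  by move=> /(_ u); rewrite DPsi// DM mulKmx.
have small q : U q -> `|Psi (e0, q)| <= r / 4 by move=> /UP[].
have /choice[eh ehP] : forall q, exists e, U q -> `|e - e0| < r /\ Psi (e, q) = 0.
  move=> q.
  have [Uq|nUq] := pselect (U q); last by exists 0.
  by have [e H] := newton_zero CPsi r0 inS near_id small Uq; exists e.
exists eh, U, (ball e0 r); split.
- by split.
- by split; [exact: ball_open | exact: ballxx].
- move=> q Uq; have [ehr Peh] := ehP q Uq; split.
  + by apply: inS => //; exact: ltW.
  + by rewrite -ball_normE /ball_/= distrC.
  + move=> e; rewrite -ball_normE /ball_/= distrC => /ltW er.
    split => [/Psi_eq0|->]; last by apply/Psi_eq0.
    exact: (implicit_unique CPsi inS near_id ehP).
- apply/esym; apply: (implicit_unique CPsi inS near_id ehP) => //.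
  by rewrite subrr normr0 ltW.
- split; first exact: (implicit_C1 CPsi oU inS near_id ehP).
  move=> q v Uq; have [/ltW ehr _] := ehP q Uq.
  have := implicit_derive CPsi oU inS near_id ehP v Uq.
  rewrite DPsi; last exact: inS.
  move=> /(congr1 (mulmx M)); rewrite mulKVmx// mulmx0.
  exact.
Qed.

End implicit_function.

(** * The KKT map *)

Lemma derive_linear (R : realType) (V W : normedModType R) (f : {linear V -> W}) z v :
  continuous f -> 'D_v f z = f v.
Proof.
by move=> cf; rewrite deriveE ?diff_lin//; exact: linear_differentiable.
Qed.

Section partial.
Context {R : realType}.

Lemma derive_pairl (V P W : normedModType R) (Phi : V * P -> W) x q u :
  'D_u (fun y => Phi (y, q)) x = 'D_((u, 0 : P)) Phi (x, q).
Proof.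
rewrite /derive; set f1 := (X in lim (X @ _)); set f2 := (X in _ = lim (X @ _)).
suff -> : f1 = f2 by [].
apply/funext => h; rewrite /f1 /f2 /=.
by congr (_ *: (Phi _ - _)); apply: injective_projections; rewrite //= scaler0 add0r.
Qed.

Lemma derive_pairr (V P W : normedModType R) (Phi : V * P -> W) x q u :
  'D_u (fun y => Phi (x, y)) q = 'D_((0 : V, u)) Phi (x, q).
Proof.
rewrite /derive; set f1 := (X in lim (X @ _)); set f2 := (X in _ = lim (X @ _)).
suff -> : f1 = f2 by [].
apply/funext => h; rewrite /f1 /f2 /=.
by congr (_ *: (Phi _ - _)); apply: injective_projections; rewrite //= scaler0 add0r.
Qed.

Lemma jac_mul a b (f : 'cV[R]_a -> 'cV[R]_b) y u :
  differentiable f y -> jac f y *m u = 'D_u f y.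
Proof.
move=> df; apply/matrixP => i j; rewrite ord1 {j}.
rewrite deriveE// [X in 'd f y X](matrix_sum_delta u) linear_sum/= summxE !mxE.
apply: eq_bigr => k _; rewrite big_ord1 linearZ !mxE -deriveE//.
by rewrite mulrC.
Qed.

Lemma differentiable_pairl (V P W : normedModType R) (Phi : V * P -> W) x q :
  differentiable Phi (x, q) -> differentiable (fun y => Phi (y, q)) x.
Proof.
move=> dPhi; apply: (@differentiable_comp _ _ _ _ (fun y => (y, q)) Phi) => //.
Qed.

Lemma differentiable_pairr (V P W : normedModType R) (Phi : V * P -> W) x q :
  differentiable Phi (x, q) -> differentiable (fun y => Phi (x, y)) q.
Proof.
move=> dPhi; apply: (@differentiable_comp _ _ _ _ (fun y => (x, y)) Phi) => //.
Qed.

Lemma differentiable_col_mx (V : normedModType R) m1 m2 n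
    (f : V -> 'M[R]_(m1, n)) (h : V -> 'M[R]_(m2, n)) z :
  differentiable f z -> differentiable h z ->
  differentiable (fun y => col_mx (f y) (h y)) z.
Proof.
move=> df dh; apply: differentiable_mx => i j.
rewrite -(splitK i); case: (fintype.split i) => k /=.
  rewrite (_ : (fun _ => _) = (fun y => f y k j)); last first.
    by apply/funext => y; rewrite col_mxEu.
  apply: (@differentiable_comp _ _ _ _ f (fun A => A k j)) => //.
  exact: differentiable_coord.
rewrite (_ : (fun _ => _) = (fun y => h y k j)); last first.
  by apply/funext => y; rewrite col_mxEd.
apply: (@differentiable_comp _ _ _ _ h (fun A => A k j)) => //.
exact: differentiable_coord.
Qed.

Lemma derive_col_mx (V : normedModType R) m1 m2 n
    (f : V -> 'M[R]_(m1, n)) (h : V -> 'M[R]_(m2, n)) z v :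
  differentiable f z -> differentiable h z ->
  'D_v (fun y => col_mx (f y) (h y)) z = col_mx ('D_v f z) ('D_v h z).
Proof.
move=> df dh; apply/matrixP => i j.
rewrite derive_coord; last exact: differentiable_col_mx.
rewrite -(splitK i); case: (fintype.split i) => k /=.
  rewrite col_mxEu derive_coord//; congr ('D_v _ z).
  by apply/funext => y; rewrite col_mxEu.
rewrite col_mxEd derive_coord//; congr ('D_v _ z).
by apply/funext => y; rewrite col_mxEd.
Qed.

Lemma C1_on_col_mx (V : normedModType R) m1 m2 n (U : set V)
    (f : V -> 'M[R]_(m1, n)) (h : V -> 'M[R]_(m2, n)) :
  open U -> C1_on U f -> C1_on U h ->
  C1_on U (fun y => col_mx (f y) (h y)).
Proof.
move=> oU Cf Ch; apply: C1_on_mx => // i j.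
rewrite -(splitK i); case: (fintype.split i) => k /=.
  rewrite (_ : (fun _ => _) = (fun y => f y k j)); first exact: C1_on_coord.
  by apply/funext => y; rewrite col_mxEu.
rewrite (_ : (fun _ => _) = (fun y => h y k j)); first exact: C1_on_coord.
by apply/funext => y; rewrite col_mxEd.
Qed.

End partial.

Section block_diag_theory.
Context {R : realType} {n : nat}.

Lemma block_diag_mul (p q : 'I_n -> nat) (B : forall i, 'M[R]_(p i, q i)) m
    (x : 'M[R]_(\sum_i q i, m)) i :
  submxcol (block_diag B *m x) i = B i *m submxcol x i.
Proof.
rewrite -submxcol_mul /block_diag mxblockEv mxcolK -[x in LHS]submxcolK.
rewrite mul_mxrow_mxcol (bigD1 i)//= eqxx conform_mx_id.
by rewrite big1 ?addr0// => j ji; rewrite eq_sym (negPf ji) mul0mx.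
Qed.

Lemma tr_block_diag (p q : 'I_n -> nat) (B : forall i, 'M[R]_(p i, q i)) :
  (block_diag B)^T = block_diag (fun i => (B i)^T).
Proof.
rewrite /block_diag tr_mxblock; apply: eq_mxblock => i j.
rewrite eq_sym; case: eqP => [->|_]; last by rewrite trmx0.
by rewrite !conform_mx_id.
Qed.

Lemma Diag_mulE m (u y : 'cV[R]_m) k : (Diag u *m y) k 0 = u k 0 * y k 0.
Proof. by rewrite /Diag mul_diag_mx !mxE. Qed.

Lemma submxcol_Diag_mul (p : 'I_n -> nat) (u y : 'cV[R]_(\sum_i p i)) i :
  submxcol (Diag u *m y) i = Diag (submxcol u i) *m submxcol y i.
Proof.
by apply/matrixP => k j; rewrite ord1 Diag_mulE [LHS]mxE Diag_mulE !mxE.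
Qed.

End block_diag_theory.

Section kkt.
Context {R : realType} {n p : nat} (g : game R n p).

Local Notation action := 'cV[R]_(\sum_i dimX g i).
Local Notation imult := 'cV[R]_(\sum_i nineq g i).
Local Notation emult := 'cV[R]_(\sum_i neqc g i).
Local Notation leader := 'cV[R]_p.
Local Notation kktvec :=
  'cV[R]_(\sum_i dimX g i + (\sum_i nineq g i + \sum_i neqc g i)).
Local Notation kktdom := (kktvec * leader)%type.

(** Direction of a unilateral deviation: by [deviate_embed], moving follower [i] by [w] adds
    [embed w] to the joint action. *)
Definition embed i (w : 'cV[R]_(dimX g i)) : action :=
  \mxcol_j @dfwith _ (fun k => 'cV[R]_(dimX g k)) (fun=> 0) i w j.

Lemma submxcol_embed i (w : 'cV[R]_(dimX g i)) : submxcol (embed w) i = w.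
Proof. by rewrite /embed mxcolK dfwithin. Qed.

Lemma submxcol_embed_neq i (w : 'cV[R]_(dimX g i)) j :
  i != j -> submxcol (embed w) j = 0.
Proof. by move=> ij; rewrite /embed mxcolK dfwithout. Qed.

Lemma submxcol_deviate i x (y : 'cV[R]_(dimX g i)) :
  submxcol (deviate i x y) i = y.
Proof. by rewrite /deviate mxcolK dfwithin. Qed.

Lemma submxcol_deviate_neq i x (y : 'cV[R]_(dimX g i)) j :
  i != j -> submxcol (deviate i x y) j = submxcol x j.
Proof. by move=> ij; rewrite /deviate mxcolK dfwithout. Qed.

Lemma deviate_embed i x (w : 'cV[R]_(dimX g i)) :
  deviate i x (submxcol x i + w) = x + embed w.
Proof.
apply/mxcolP => j; rewrite submxcolD.
have [<-|ij] := eqVneq i j.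
  by rewrite submxcol_deviate submxcol_embed.
by rewrite submxcol_deviate_neq// submxcol_embed_neq// addr0.
Qed.

Lemma embed0 i : embed (0 : 'cV[R]_(dimX g i)) = 0.
Proof.
apply/mxcolP => j; rewrite submxcol0; have [<-|ij] := eqVneq i j.
  by rewrite submxcol_embed.
by rewrite submxcol_embed_neq.
Qed.

Lemma embed_is_linear i : linear (@embed i).
Proof.
move=> a u v; apply/mxcolP => j; rewrite submxcolD.
have -> : submxcol (a *: embed u) j = a *: submxcol (embed u) j.
  by apply/matrixP => k l; rewrite !mxE.
have [<-|ij] := eqVneq i j; first by rewrite !submxcol_embed.
by rewrite !submxcol_embed_neq// scaler0 addr0.
Qed.

Lemma deviate_id i x : deviate i x (submxcol x i) = x :> action.
Proof. by rewrite -[submxcol x i]addr0 deviate_embed embed0 addr0. Qed.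

Definition objz i (z : action * leader) : R := obj g i z.1 z.2.

(** This reads a derivative in follower [i]'s own block as a directional derivative of the joint
    objective, the only kind that [smooth_game] controls. *)
Lemma derive_deviate i x q w :
  'D_w (fun y => obj g i (deviate i x y) q) (submxcol x i) =
  'D_((embed w, 0 : leader)) (objz i) (x, q).
Proof.
rewrite /derive; set f1 := (X in lim (X @ _)); set f2 := (X in _ = lim (X @ _)).
suff -> : f1 = f2 by [].
apply/funext => h; rewrite /f1 /f2 /objz /= deviate_id scaler0 add0r.
rewrite [_ *: w + _]addrC deviate_embed -[h *: w]addr0 embed_is_linear embed0 addr0.
by rewrite [_ + x]addrC.
Qed.

Definition Fz (z : action * leader) : action := Fmap z.1 z.2.

Context {Pi : set leader} (smooth : smooth_game g Pi).

Let S : set (action * leader) := setT `*` Pi°.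

Lemma open_game_domain : open S.
Proof.
rewrite /S (_ : _ `*` _ = snd @^-1` Pi°); last by apply/seteqP; split => [z []|].
apply: open_comp; last exact: open_interior.
by move=> z _; exact: cvg_snd.
Qed.

(** Entry [s] of [F] is the derivative of one objective along a basis vector of its own block;
    [tagnat.sig1 s] and [tagnat.sig2 s] are the follower and the coordinate. The second half of
    [C2_on] then applies. *)
Lemma C1_Fz : C1_on S Fz.
Proof.
apply: C1_on_mx; first exact: open_game_domain.
move=> s j; rewrite ord1 {j}.
rewrite (_ : (fun _ => _) =
  'D_((embed (delta_mx (tagnat.sig2 s) 0), 0 : leader)) (objz (tagnat.sig1 s))).
  exact: (smooth _).2.
by apply/funext => -[x q]; rewrite -derive_deviate /Fz /Fmap !mxE.
Qed.

Lemma derive_objz i x q (w : 'cV[R]_(dimX g i)) : Pi° q ->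
  'D_((embed w, 0 : leader)) (objz i) (x, q) =
    \sum_k w k 0 * (own_grad i x q) k 0.
Proof.
move=> Pq; have dobj : differentiable (objz i) (x, q).
  by have [+ _] := smooth i; move=> /(_ (x, q) (conj I Pq))[].
rewrite -derive_pairl; rewrite deriveE; last exact: differentiable_pairl.
pose em : {linear _ -> _} := HB.pack (@embed i)
  (GRing.isLinear.Build _ _ _ _ _ (@embed_is_linear i)).
rewrite -[embed w]/(em w) {1}(matrix_sum_delta w) !linear_sum.
apply: eq_bigr => k _; rewrite big_ord1 !linearZ /= mxE derive_deviate -derive_pairl.
by rewrite -deriveE//; exact: differentiable_pairl.
Qed.


Definition bvec : emult := \mxcol_i bi g i.

Definition xpart : {linear kktdom -> action} := usubmx \o fst.
Definition lpart : {linear kktdom -> imult} :=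
  usubmx \o (dsubmx \o fst).
Definition npart : {linear kktdom -> emult} :=
  dsubmx \o (dsubmx \o fst).

Lemma xpart_continuous : continuous xpart.
Proof.
move=> z; apply: (@continuous_comp _ _ _ fst usubmx); first exact: cvg_fst.
exact: linear_mx_continuous.
Qed.

Lemma lpart_continuous : continuous lpart.
Proof.
move=> z; apply: (@continuous_comp _ _ _ fst (usubmx \o dsubmx)).
  exact: cvg_fst.
exact: linear_mx_continuous.
Qed.

Lemma npart_continuous : continuous npart.
Proof.
move=> z; apply: (@continuous_comp _ _ _ fst (dsubmx \o dsubmx)).
  exact: cvg_fst.
exact: linear_mx_continuous.
Qed.

Definition xqpart (z : kktdom) : (action * leader)%type := (xpart z, z.2).

Lemma xqpart_is_linear : linear xqpart.
Proof. by move=> a u v; rewrite /xqpart linearP. Qed.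

HB.instance Definition _ :=
  GRing.isLinear.Build R kktdom (action * leader)%type _ xqpart xqpart_is_linear.

Lemma xqpart_continuous : continuous xqpart.
Proof.
by move=> z; apply: for_continuous_pair; [exact: xpart_continuous | exact: cvg_snd].
Qed.

Definition KKT_stat (z : kktdom) : action :=
  Fz (xqpart z) + ((Gmx g)^T *m lpart z + (Amx g)^T *m npart z).

Definition KKT_compl (z : kktdom) : imult :=
  Diag (lpart z) *m (Gmx g *m xpart z - hvec g).

Definition KKT_eq (z : kktdom) : emult := Amx g *m xpart z - bvec.

Definition KKTmap (z : kktdom) : kktvec :=
  col_mx (KKT_stat z) (col_mx (KKT_compl z) (KKT_eq z)).

Lemma KKT_KKTmap x l v q :
  KKT x l v q <-> KKTmap (col_mx x (col_mx l v), q) = 0.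
Proof.
rewrite /KKTmap /KKT_stat /KKT_compl /KKT_eq /xqpart /= !(col_mxKu, col_mxKd).
have stat i : submxcol (Fz (x, q) + ((Gmx g)^T *m l + (Amx g)^T *m v)) i =
    own_grad i x q + (Gi g i)^T *m submxcol l i + (Ai g i)^T *m submxcol v i.
  rewrite !submxcolD /Fz /Fmap mxcolK /Gmx /Amx !tr_block_diag !block_diag_mul.
  by rewrite addrA.
have compl i : submxcol (Diag l *m (Gmx g *m x - hvec g)) i =
    Diag (submxcol l i) *m (Gi g i *m submxcol x i - hi g i).
  by rewrite submxcol_Diag_mul submxcolB block_diag_mul /hvec mxcolK.
have eq i : submxcol (Amx g *m x - bvec) i = Ai g i *m submxcol x i - bi g i.
  by rewrite submxcolB block_diag_mul /bvec mxcolK.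
have -> : (0 : kktvec) = col_mx 0 (col_mx 0 0) by rewrite !col_mx0.
split=> [H|/eq_col_mx[H1 /eq_col_mx[H2 H3]] i].
  congr col_mx; [|congr col_mx]; apply/mxcolP => i; rewrite submxcol0;
    have [H1 H2 H3] := H i.
  - by rewrite stat.
  - by rewrite compl.
  - by rewrite eq H3 subrr.
split; first by rewrite -stat H1 submxcol0.
  by rewrite -compl H2 submxcol0.
by apply/eqP; rewrite -subr_eq0 -eq H3 submxcol0.
Qed.

Let SK : set (kktdom) := [set z | Pi° z.2].

Lemma open_KKT_domain : open SK.
Proof.
rewrite /SK (_ : mkset _ = snd @^-1` Pi°)//.
apply: open_comp; last exact: open_interior.
by move=> z _; exact: cvg_snd.
Qed.

Lemma C1_KKT_stat : C1_on SK KKT_stat.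
Proof.
have oSK := open_KKT_domain; apply: C1_onD; first exact: oSK.
  apply: (@C1_on_sub _ _ _ _ (xqpart @^-1` S)); first by move=> z Sz; split.
  exact: C1_on_comp_linear xqpart_continuous C1_Fz.
apply: C1_onD; first exact: oSK.
  apply: (@C1_on_linear_comp _ _ _ _ _ (mulmx (Gmx g)^T) lpart oSK).
    exact: linear_mx_continuous.
  exact: C1_on_linear oSK lpart_continuous.
apply: (@C1_on_linear_comp _ _ _ _ _ (mulmx (Amx g)^T) npart oSK).
  exact: linear_mx_continuous.
exact: C1_on_linear oSK npart_continuous.
Qed.

Lemma C1_affine m (M : 'M[R]_(m, _)) (c : 'cV[R]_m) :
  C1_on SK (fun z => M *m xpart z - c).
Proof.
have oSK := open_KKT_domain; apply: C1_onD; [exact: oSK | | exact: C1_on_cst oSK].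
apply: (@C1_on_linear_comp _ _ _ _ _ (mulmx M) xpart oSK).
  exact: linear_mx_continuous.
exact: C1_on_linear oSK xpart_continuous.
Qed.

Lemma C1_KKT_compl : C1_on SK KKT_compl.
Proof.
have oSK := open_KKT_domain; apply: C1_on_mx; [exact: oSK | move=> i j; rewrite ord1].
rewrite (_ : (fun _ => _) = (fun z => lpart z i 0 *
    (Gmx g *m xpart z - hvec g) i 0)); last first.
  by apply/funext => z; rewrite /KKT_compl Diag_mulE.
apply: C1_onM; [exact: oSK | | by apply: (C1_on_coord _ _ oSK); exact: C1_affine].
apply: (C1_on_coord _ _ oSK); exact: C1_on_linear oSK lpart_continuous.
Qed.

Lemma C1_KKTmap : C1_on SK KKTmap.
Proof.
have C1_KKT_eq : C1_on SK KKT_eq by exact: C1_affine.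
exact: (C1_on_col_mx open_KKT_domain C1_KKT_stat
  (C1_on_col_mx open_KKT_domain C1_KKT_compl C1_KKT_eq)).
Qed.

Lemma derive_affine z v m (M : 'M[R]_(m, _)) (c : 'cV[R]_m) :
  'D_v (fun z => M *m xpart z - c) z = M *m xpart v.
Proof.
have cM : continuous (mulmx M \o xpart).
  move=> y; apply: continuous_comp; first exact: xpart_continuous.
  exact: linear_mx_continuous.
have -> : 'D_v (fun z => M *m xpart z - c) z =
  'D_v ((mulmx M \o xpart) - cst c) z by [].
rewrite deriveB ?derive_cst ?subr0 ?derive_linear//.
by apply: diff_derivable; exact: linear_differentiable.
Qed.

Lemma derive_Fz x q dx dq : Pi° q ->
  'D_((dx, dq)) Fz (x, q) = jac (fun y => Fmap y q) x *m dx + jac (Fmap x) q *m dq.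
Proof.
move=> Pq; have dF : differentiable Fz (x, q) 
  by have Sz : S (x, q) by []; exact: (C1_Fz Sz).1.
rewrite jac_mul; last exact: (differentiable_pairl dF).
rewrite jac_mul; last exact: (differentiable_pairr dF).
rewrite (derive_pairl Fz) (derive_pairr Fz) !deriveE// -linearD.
by congr ('d _ _ _); apply: injective_projections; rewrite //= ?addr0 ?add0r.
Qed.

(** Apart from [F], only complementarity is nonlinear, and the product rule there produces its two
    blocks. With [w = 0] the formula identifies [KKT_mx] as the partial derivative to be inverted;
    along the branch it becomes the sensitivity system. *)
Lemma derive_KKTmap x l v q (u : kktvec) (w : leader) : Pi° q ->
  'D_((u, w)) KKTmap (col_mx x (col_mx l v), q) =
  KKT_mx x l q *m u + col_mx (jac (Fmap x) q *m w) 0.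
Proof.
move=> Pq; set z := (col_mx x (col_mx l v), q).
have Sz : SK z by [].
have xz : xpart z = x by rewrite /= col_mxKu.
have lz : lpart z = l by rewrite /= col_mxKd col_mxKu.
have dstat := (C1_KKT_stat Sz).1.
have dcompl := (C1_KKT_compl Sz).1.
have deq : differentiable KKT_eq z by exact: (C1_affine _ _ Sz).1.
rewrite derive_col_mx//; last exact: differentiable_col_mx.
rewrite derive_col_mx//.
have -> : 'D_((u, w)) KKT_eq z = Amx g *m xpart (u, w) by exact: derive_affine.
have -> : 'D_((u, w)) KKT_compl z = Diag l *m (Gmx g *m xpart (u, w)) +
    Diag (Gmx g *m x - hvec g) *m lpart (u, w).
  apply/matrixP => i j; rewrite ord1 {j} derive_coord// mxE !Diag_mulE.
  rewrite (_ : (fun _ => _) = (fun z => lpart z i 0) *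
    (fun z => (Gmx g *m xpart z - hvec g) i 0)); last first.
    by apply/funext => y; rewrite /KKT_compl Diag_mulE.
  have dl : differentiable lpart z.
    exact: linear_differentiable lpart_continuous.
  have da := (C1_affine (Gmx g) (hvec g) Sz).1.
  have dcoord m (f : kktdom -> 'cV[R]_m) k : differentiable f z ->
      derivable (fun y => f y k 0) z (u, w).
    move=> df; apply: diff_derivable.
    apply: (@differentiable_comp _ _ _ _ f (fun A => A k 0)) => //.
    exact: differentiable_coord.
  rewrite deriveM; [|exact: dcoord..].
  rewrite -!derive_coord// derive_affine derive_linear; last first.
    exact: lpart_continuous.
  by rewrite xz lz.
have -> : 'D_((u, w)) KKT_stat z = jac (fun y => Fmap y q) x *m xpart (u, w) +
    jac (Fmap x) q *m w + ((Gmx g)^T *m lpart (u, w) + (Amx g)^T *m npart (u, w)).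
  have cl : continuous (mulmx (Gmx g)^T \o lpart).
    move=> y; apply: continuous_comp; first exact: lpart_continuous.
    exact: linear_mx_continuous.
  have cn : continuous (mulmx (Amx g)^T \o npart).
    move=> y; apply: continuous_comp; first exact: npart_continuous.
    exact: linear_mx_continuous.
  rewrite (_ : KKT_stat = (Fz \o xqpart) +
    ((mulmx (Gmx g)^T \o lpart) + (mulmx (Amx g)^T \o npart)))//.
  have dl := linear_differentiable z cl.
  have dn := linear_differentiable z cn.
  have dF : differentiable (Fz \o xqpart) z.
    apply: differentiable_comp; first exact: linear_differentiable xqpart_continuous.
    by have Sxq : S (xqpart z) by []; exact: (C1_Fz Sxq).1.
  rewrite deriveD; [|exact: diff_derivable|]; last first.
    by apply: diff_derivable; exact: differentiableD.
  rewrite deriveD; [|exact: diff_derivable..].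
  have -> : 'D_((u, w)) (Fz \o xqpart) z = 'D_((xpart (u, w), w)) Fz (x, q).
    rewrite -[in RHS]xz; exact: derive_comp_linear.
  by rewrite derive_Fz// !derive_linear.
have uE : u = col_mx (xpart (u, w)) (col_mx (lpart (u, w)) (npart (u, w))).
  by rewrite /= !vsubmxK.
rewrite /KKT_mx [X in block_mx _ _ _ _ *m X]uE.
rewrite mul_block_col mul_row_col mul_col_mx mul_block_col.
rewrite !mul0mx !addr0 !add_col_mx !addr0 -mulmxA.
by congr col_mx; rewrite addrAC.
Qed.

End kkt.

(** * Equilibria and multipliers *)

Section linear_algebra.
Context {R : realType}.

(** The columns of [cokermx C] lie in the kernel of [C], so [w] kills them, and that is the
    criterion [submxE]. The coefficients obtained are the unsigned multipliers of [NE_KKT]. *)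
Lemma row_sub_of_kernel (m n : nat) (C : 'M[R]_(m, n)) (w : 'rV[R]_n) :
  (forall d : 'cV[R]_n, C *m d = 0 -> w *m d = 0) -> (w <= C)%MS.
Proof.
move=> H; rewrite submxE; apply/eqP/matrixP => i j.
have := H (cokermx C *m delta_mx j 0).
rewrite mulmxA mulmx_coker mul0mx => /(_ erefl).
by rewrite -colE colE mulmxA -colE => /matrixP/(_ i 0); rewrite !mxE.
Qed.

Definition dot n (u v : 'cV[R]_n) : R := \sum_k u k 0 * v k 0.

Lemma dotE n (u v : 'cV[R]_n) : u^T *m v = (dot u v)%:M.
Proof.
apply/matrixP => i j; rewrite !ord1 !mxE eqxx mulr1n.
by apply: eq_bigr => k _; rewrite mxE.
Qed.

Lemma dotDr n (u v w : 'cV[R]_n) : dot u (v + w) = dot u v + dot u w.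
Proof. by rewrite /dot -big_split; apply: eq_bigr => k _; rewrite mxE mulrDr. Qed.

Lemma dot_trmx m n (M : 'M[R]_(m, n)) (u : 'cV[R]_n) (v : 'cV[R]_m) :
  dot u (M^T *m v) = dot v (M *m u).
Proof.
have : (dot u (M^T *m v))%:M = (dot v (M *m u))%:M :> 'M[R]_1.
  by rewrite -(dotE u) -[RHS]tr_scalar_mx -dotE !trmx_mul !trmxK mulmxA.
by move/matrixP/(_ 0 0); rewrite !mxE eqxx !mulr1n.
Qed.

Lemma dotC n (u v : 'cV[R]_n) : dot u v = dot v u.
Proof. by apply: eq_bigr => k _; rewrite mulrC. Qed.

Lemma dot0r n (u : 'cV[R]_n) : dot u 0 = 0.
Proof. by rewrite /dot big1// => k _; rewrite mxE mulr0. Qed.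

Lemma dotNl n (u v : 'cV[R]_n) : dot (- u) v = - dot u v.
Proof. by rewrite /dot -sumrN; apply: eq_bigr => k _; rewrite mxE mulNr. Qed.

End linear_algebra.

Section right_derivative.
Context {R : realType} {V : normedModType R}.

(** Feasible moves are one-sided, but the two-sided limit exists and equals the right one. *)
Lemma derive_right_le (f : V -> R) x v c : differentiable f x ->
  (\forall t \near (0 : R)^'+, f (t *: v + x) - f x <= t * c) ->
  'D_v f x <= c.
Proof.
move=> df H.
have dv : h^-1 *: (f (h *: v + x) - f x) @[h --> (0 : R)^'] --> 'D_v f x.
  exact: (@diff_derivable _ _ _ f x v df).
have dr := cvg_dnbhs_at_right dv.
apply: (cvgr_to_le dr); near=> t.
have t0 : 0 < t by near: t; exact: nbhs_right_gt.
rewrite [leLHS]mulrC ler_pdivrMr// mulrC.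
by near: t.
Unshelve. all: by end_near. Qed.

Lemma derive_right_ge0 (f : V -> R) x v : differentiable f x ->
  (\forall t \near (0 : R)^'+, f x <= f (t *: v + x)) -> 0 <= 'D_v f x.
Proof.
move=> df H; rewrite -oppr_le0 -deriveN; last exact: diff_derivable.
apply: derive_right_le; first exact: differentiableN.
by apply: filterS H => t ft; rewrite mulr0 !fctE opprK addrC subr_le0.
Qed.

End right_derivative.

Section equilibria.
Context {R : realType} {n p : nat} (g : game R n p).

Local Notation action := 'cV[R]_(\sum_i dimX g i).
Local Notation imult := 'cV[R]_(\sum_i nineq g i).
Local Notation emult := 'cV[R]_(\sum_i neqc g i).
Local Notation leader := 'cV[R]_p.

(** Sign convention of the KKT matrix: nonpositive at feasible points. *)
Definition slack (x : action) : imult := Gmx g *m x - hvec g.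

Lemma slack_Rank x i r :
  slack x (tagnat.Rank i r) 0 = (Gi g i *m submxcol x i - hi g i) r 0.
Proof.
transitivity (submxcol (slack x) i r 0); first by rewrite [RHS]mxE.
by rewrite /slack submxcolB block_diag_mul /hvec mxcolK.
Qed.

Lemma KKTE x l v q : KKT x l v q <->
  [/\ Fmap x q + ((Gmx g)^T *m l + (Amx g)^T *m v) = 0,
      Diag l *m slack x = 0 & Amx g *m x = bvec g].
Proof.
rewrite KKT_KKTmap /KKTmap /KKT_stat /KKT_compl /KKT_eq /xqpart /=.
rewrite !(col_mxKu, col_mxKd).
split=> [/eqP|[-> -> ->]]; last by rewrite subrr !col_mx0.
by rewrite !col_mx_eq0 subr_eq0 => /and3P[/eqP ? /eqP ? /eqP ?].
Qed.

Lemma KKT_compl0 x l v q s : KKT x l v q -> l s 0 * slack x s 0 = 0.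
Proof. by move=> /KKTE[_ H _]; rewrite -Diag_mulE H mxE. Qed.

Lemma slack_le0 x s : (forall i, feasible i (submxcol x i)) -> slack x s 0 <= 0.
Proof.
move=> fx; rewrite -(tagnat.sig2K s) slack_Rank !mxE subr_le0.
by have [_ /(_ (tagnat.sig2 s))] := fx (tagnat.sig1 s); rewrite mxE.
Qed.

Lemma feasibleP x : Amx g *m x = bvec g -> (forall s, slack x s 0 <= 0) ->
  forall i, feasible i (submxcol x i).
Proof.
move=> Ax sx i; split.
  by rewrite -block_diag_mul -/(Amx g) Ax /bvec mxcolK.
by move=> r; have := sx (tagnat.Rank i r); rewrite slack_Rank !mxE subr_le0.
Qed.

(** Solving [M y = (0, c, 0)] and reading the last two block rows gives a direction that preserves
    the equality constraints and has prescribed rates on the active inequalities. *)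
Lemma KKT_mx_solve x l q (c : imult) : KKT_mx x l q \in unitmx ->
  exists (d : action) (dl : imult), Amx g *m d = 0 /\
    forall s, l s 0 * (Gmx g *m d) s 0 + slack x s 0 * dl s 0 = c s 0.
Proof.
move=> uM; pose y := invmx (KKT_mx x l q) *m col_mx 0 (col_mx c 0).
have : KKT_mx x l q *m y = col_mx 0 (col_mx c 0) by rewrite mulKVmx.
rewrite -[y]vsubmxK -[dsubmx y]vsubmxK.
move: (usubmx y) (usubmx (dsubmx y)) (dsubmx (dsubmx y)) => d dl dn.
rewrite /KKT_mx mul_block_col mul_row_col mul_col_mx mul_block_col.
rewrite !mul0mx !addr0 !add_col_mx !addr0 -mulmxA => /eq_col_mx[_ /eq_col_mx[E1 E2]].
exists d, dl; split => // s.
by rewrite -E1 [in RHS]mxE !Diag_mulE.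
Qed.

Lemma strict_complementarity x l q s : KKT_mx x l q \in unitmx ->
  slack x s 0 = 0 -> l s 0 != 0.
Proof.
move=> uM s0; have [d [dl [_ /(_ s)]]] := KKT_mx_solve (const_mx 1) uM.
rewrite s0 mul0r addr0 [RHS]mxE => E; apply: contra_eq_neq E => ->.
by rewrite mul0r eq_sym oner_eq0.
Qed.

Context {Pi : set leader} (smooth : smooth_game g Pi).

Lemma differentiable_objz i x q : Pi° q -> differentiable (objz (g:=g) i) (x, q).
Proof.
move=> Pq; have Sxq : ([set: action] `*` Pi°) (x, q) by [].
exact: ((smooth i).1 _ Sxq).1.
Qed.

Lemma derive_objz_dot i x q (w : 'cV[R]_(dimX g i)) : Pi° q ->
  'D_((embed w, 0 : leader)) (objz i) (x, q) = dot w (own_grad i x q).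
Proof. by move=> Pq; rewrite (derive_objz smooth). Qed.

(** A constraint that [d] tightens must be inactive at [x]; it then tolerates any step up to its
    remaining margin divided by its rate. *)
Lemma near_feasible i (x d : 'cV[R]_(dimX g i)) : feasible i x ->
  Ai g i *m d = 0 ->
  (forall r, (Gi g i *m x - hi g i) r 0 = 0 -> (Gi g i *m d) r 0 <= 0) ->
  \forall t \near (0 : R)^'+, feasible i (x + t *: d).
Proof.
move=> [Ax Gx] Ad Gd.
have H : \forall t \near (0 : R)^'+, forall r : 'I_(nineq g i),
    (Gi g i *m (x + t *: d)) r 0 <= hi g i r 0.
  apply: filter_forall => r.
  have [rd|rd] := leP ((Gi g i *m d) r 0) 0.
    near=> t; have t0 : 0 < t by near: t; exact: nbhs_right_gt.
    rewrite mulmxDr -scalemxAr mxE [X in _ + X]mxE.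
    rewrite -[leRHS]addr0; apply: lerD; first exact: Gx.
    by rewrite mulr_ge0_le0// ltW.
  have sl : (Gi g i *m x) r 0 < hi g i r 0.
    rewrite lt_neqAle Gx andbT; apply/eqP => E.
    have : (Gi g i *m d) r 0 <= 0 by apply: Gd; rewrite !mxE -E mxE subrr.
    by rewrite leNgt rd.
  near=> t; rewrite mulmxDr -scalemxAr mxE [X in _ + X]mxE.
  rewrite -lerBrDl -ler_pdivlMr//; near: t; apply: nbhs_right_le.
  by apply: divr_gt0; rewrite ?subr_gt0.
apply: filterS H => t H; split=> [|r]; last exact: H.
by rewrite mulmxDr -scalemxAr Ad scaler0 addr0.
Unshelve. all: by end_near. Qed.

Lemma NE_first_order q x i (d : 'cV[R]_(dimX g i)) : Pi° q -> is_NE q x ->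
  Ai g i *m d = 0 ->
  (forall r, (Gi g i *m submxcol x i - hi g i) r 0 = 0 ->
     (Gi g i *m d) r 0 <= 0) ->
  0 <= dot d (own_grad i x q).
Proof.
move=> Pq NEx Ad Gd; have [fx opt] := NEx i.
rewrite -derive_objz_dot//; apply: derive_right_ge0.
  exact: differentiable_objz.
apply: filterS (near_feasible fx Ad Gd) => t ft.
have := opt _ ft; rewrite deviate_embed /objz /= scaler0 add0r.
have -> : embed (t *: d) = t *: embed d.
  by rewrite -[t *: d]addr0 embed_is_linear embed0 addr0.
by rewrite [_ + x]addrC.
Qed.

Lemma KKT_own_grad x l v q i (w : 'cV[R]_(dimX g i)) : KKT x l v q ->
  dot w (own_grad i x q) =
  - (dot (submxcol l i) (Gi g i *m w) + dot (submxcol v i) (Ai g i *m w)).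
Proof.
move=> /(_ i)[E _ _].
have : dot w (own_grad i x q + (Gi g i)^T *m submxcol l i
          + (Ai g i)^T *m submxcol v i) = 0 by rewrite E dot0r.
by rewrite !dotDr !dot_trmx -addrA => /eqP; rewrite addr_eq0 => /eqP.
Qed.

Lemma NE_mult_ge0 q (x : action) l v s : Pi° q -> is_NE q x -> KKT x l v q ->
  KKT_mx x l q \in unitmx -> 0 <= l s 0.
Proof.
move=> Pq NEx kx uM; rewrite leNgt; apply/negP => ls.
(* By strict complementarity the multipliers of active constraints can be cancelled, so [G d] is -1
   at [s] and 0 at the other active constraints. Thus [d] is a feasible direction, and the slope of
   the objective along it is exactly [l s 0]. *)
have [d [dl [Ad Gd]]] := KKT_mx_solve (- l s 0 *: delta_mx s 0) uM.
have act s' : slack x s' 0 = 0 -> (Gmx g *m d) s' 0 = - (s' == s)%:R.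
  move=> s0; have ln := strict_complementarity uM s0.
  have := Gd s'; rewrite s0 mul0r addr0 !mxE eqxx andbT.
  move=> E; apply: (mulfI ln); rewrite E.
  by case: eqP => [->|_]; rewrite ?mulr0 ?oppr0 ?mulr0// mulr1 mulrN1.
have sx0 : slack x s 0 = 0.
  have /eqP := KKT_compl0 s kx; rewrite mulf_eq0 => /orP[|/eqP//].
  by rewrite lt_eqF.
set i := tagnat.sig1 s; set r := tagnat.sig2 s.
have Di : Ai g i *m submxcol d i = 0.
  by rewrite -block_diag_mul -/(Amx g) Ad submxcol0.
have GR r' : (Gi g i *m submxcol d i) r' 0 = (Gmx g *m d) (tagnat.Rank i r') 0.
  by rewrite -block_diag_mul mxE.
have := @NE_first_order q x i (submxcol d i) Pq NEx Di.
rewrite (KKT_own_grad _ kx) Di dot0r addr0.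
have -> : dot (submxcol l i) (Gi g i *m submxcol d i) = - l s 0.
  rewrite /dot (bigD1 r)//= GR [submxcol l i r 0]mxE.
  rewrite [X in _ + X]big1.
    by rewrite addr0 /i /r tagnat.sig2K act// eqxx mulrN1.
  move=> r' r'r.
  rewrite GR [submxcol l i r' 0]mxE.
  have [sl|/eqP sl] := eqVneq (slack x (tagnat.Rank i r') 0) 0.
    rewrite act// -[s]tagnat.sig2K -/i -/r.
    case: eqP => [/(congr1 val)/eqP|]; last by rewrite oppr0 mulr0.
    by rewrite /= tagnat.eq_Rank eqxx/= => /eqP/val_inj E; rewrite E eqxx in r'r.
  have /eqP := KKT_compl0 (tagnat.Rank i r') kx; rewrite mulf_eq0.
  by move=> /orP[/eqP->|/eqP//]; rewrite mul0r.
move=> H; suff : 0 <= l s 0 by rewrite leNgt ls.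
rewrite -[l s 0]opprK; apply: H => r' r'0.
rewrite GR act ?oppr_le0 ?ler0n//.
by rewrite slack_Rank.
Qed.

Lemma NE_KKT q (x : action) : Pi° q -> is_NE q x -> exists l v, KKT x l v q.
Proof.
move=> Pq NEx.
suff H i : exists lv : 'cV[R]_(nineq g i) * 'cV[R]_(neqc g i),
    own_grad i x q + (Gi g i)^T *m lv.1 + (Ai g i)^T *m lv.2 = 0 /\
    Diag lv.1 *m (Gi g i *m submxcol x i - hi g i) = 0.
  pose lv i := sval (cid (H i)).
  exists (\mxcol_i (lv i).1), (\mxcol_i (lv i).2) => i; rewrite !mxcolK.
  have [E1 E2] := svalP (cid (H i)).
  by split => //; have [[]] := NEx i.
(* Indicator of the active constraints. [Diag a] erases the inactive rows of [C], and multiplying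
   the coefficients by it makes complementarity automatic. *)
pose a : 'cV[R]_(nineq g i) :=
  \col_r ((Gi g i *m submxcol x i - hi g i) r 0 == 0)%:R.
pose C := col_mx (Diag a *m Gi g i) (Ai g i).
have : ((own_grad i x q)^T <= C)%MS.
  apply: row_sub_of_kernel => d; rewrite /C mul_col_mx => /eqP.
  rewrite col_mx_eq0 => /andP[/eqP Gd /eqP Ad].
  have Gd0 r : (Gi g i *m submxcol x i - hi g i) r 0 = 0 -> (Gi g i *m d) r 0 = 0.
    move=> r0; have ar : a r 0 = 1 by rewrite mxE r0 eqxx.
    move/matrixP: Gd => /(_ r 0).
    by rewrite -mulmxA Diag_mulE ar mul1r => ->; rewrite mxE.
  rewrite dotE dotC.
  suff -> : dot d (own_grad i x q) = 0 by apply/matrixP => ? ?; rewrite !mxE mul0rn.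
  (* Both [- d] and [d] keep the active constraints at equality, so the first-order condition
     applies to each. *)
  apply/eqP; rewrite eq_le -oppr_ge0 -dotNl; apply/andP; split.
    apply: (NE_first_order Pq NEx); first by rewrite mulmxN Ad oppr0.
    by move=> r /Gd0 E; rewrite mulmxN mxE E oppr0.
  by apply: (NE_first_order Pq NEx) => // r /Gd0->.
move=> /submxP[D]; rewrite /C -[D]hsubmxK mul_row_col => E.
exists (- (Diag a *m (lsubmx D)^T), - (rsubmx D)^T) => /=; split.
  have -> : own_grad i x q = (Gi g i)^T *m (Diag a *m (lsubmx D)^T) +
      (Ai g i)^T *m (rsubmx D)^T.
    rewrite -[LHS]trmxK E linearD /= !trmx_mul mulmxA.
    by rewrite /Diag tr_diag_mx.
  by rewrite !mulmxN -addrA -opprD subrr.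
apply/matrixP => r j; rewrite ord1 {j} Diag_mulE [X in X * _]mxE Diag_mulE.
rewrite [a r 0]mxE [RHS]mxE.
by case: eqP => [->|_]; rewrite ?mulr0// mul0r oppr0 mul0r.
Qed.

Lemma convex_first_order q x i (y : 'cV[R]_(dimX g i)) : own_convex g Pi ->
  Pi° q -> (forall j, feasible j (submxcol x j)) -> feasible i y ->
  dot (y - submxcol x i) (own_grad i x q) <=
    obj g i (deviate i x y) q - obj g i x q.
Proof.
move=> cvx Pq fx fy; rewrite -derive_objz_dot//.
apply: derive_right_le; first exact: differentiable_objz.
near=> t.
have t0 : 0 < t by near: t; exact: nbhs_right_gt.
have t1 : t <= 1 by near: t; exact: nbhs_right_le.
have t01 : 0 <= t <= 1 by rewrite ltW.
have := cvx i q x y (submxcol x i) t (interior_subset Pq) fx fy (fx i) t01.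
rewrite deviate_id.
have -> : t *: y + (1 - t) *: submxcol x i =
    submxcol x i + t *: (y - submxcol x i).
  by apply/matrixP => k j; rewrite !mxE; ring.
rewrite deviate_embed /objz /= scaler0 add0r.
have -> : embed (t *: (y - submxcol x i)) = t *: embed (y - submxcol x i).
  by rewrite -[t *: _]addr0 embed_is_linear embed0 addr0.
rewrite [_ + x]addrC; lra.
Unshelve. all: by end_near. Qed.

(** By stationarity and complementarity, the first-order term towards a feasible [y] is minus the
    sum of the products of [l] with [G y - h], hence nonnegative; convexity bounds the gain from
    below by it. *)
Lemma KKT_convex_NE q x l v : own_convex g Pi -> Pi° q ->
  KKT x l v q -> (forall s, slack x s 0 <= 0) -> (forall s, 0 <= l s 0) ->
  is_NE q x.
Proof.
move=> cvx Pq kx sx l0.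
have [_ _ Ax] := (KKTE x l v q).1 kx.
have fx := feasibleP Ax sx; move=> i; split => // y fy.
rewrite -subr_ge0; apply: le_trans (convex_first_order cvx Pq fx fy).
rewrite (KKT_own_grad _ kx).
have -> : Ai g i *m (y - submxcol x i) = 0.
  by rewrite mulmxBr (fx i).1 fy.1 subrr.
rewrite dot0r addr0 oppr_ge0 /dot; apply: sumr_le0 => r _.
have -> : (Gi g i *m (y - submxcol x i)) r 0 =
   ((Gi g i *m y) r 0 - hi g i r 0) - slack x (tagnat.Rank i r) 0.
  by rewrite slack_Rank mulmxBr !mxE; ring.
rewrite [submxcol l i r 0]mxE mulrBr (KKT_compl0 _ kx) subr0.
by rewrite mulr_ge0_le0// subr_le0; exact: fy.2.
Qed.

End equilibria.

(** * Continuity of the equilibrium oracle *)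

Section matrix_topology.
Context {R : realType}.

Lemma trmx_norm_le m n (A : 'M[R]_(m, n)) : `|A^T| <= `|A|.
Proof. by apply: mx_norm_le => // i j; rewrite mxE ler_coord_norm. Qed.

(** [bounded_closed_compact] is used on row vectors and carried over by transposition, which is
    continuous and does not increase the norm. *)
Lemma compact_closed_ball_cV N (M : R) : compact [set x : 'cV[R]_N | `|x| <= M].
Proof.
have -> : [set x : 'cV[R]_N | `|x| <= M] =
    trmx @` [set x : 'rV[R]_N | `|x| <= M].
  apply/seteqP; split => [x /= xM|_ /= [x /= xM <-]].
    by exists x^T; rewrite ?trmxK//=; exact: le_trans (trmx_norm_le _) xM.
  exact: le_trans (trmx_norm_le _) xM.
apply: continuous_compact.
  apply: continuous_subspaceT; exact: linear_mx_continuous.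
apply: bounded_closed_compact.
  exists M; split; first exact: num_real.
  by move=> r Mr x /= xM; exact: le_trans xM (ltW Mr).
rewrite (_ : mkset _ = closed_ball_ (fun x : 'rV[R]_N => `|x|) 0 M).
  exact: closed_closed_ball_.
by apply/seteqP; split => x /=; rewrite /closed_ball_/= sub0r normrN.
Qed.

Lemma cvg_col_mx (T : Type) (F : set_system T) {FF : Filter F} m1 m2 n
    (f : T -> 'M[R]_(m1, n)) (h : T -> 'M[R]_(m2, n))
    (a : 'M[R]_(m1, n)) (b : 'M[R]_(m2, n)) :
  f @ F --> a -> h @ F --> b ->
  (fun t => col_mx (f t) (h t)) @ F --> col_mx a b.
Proof.
move=> /cvgrPdist_le fa /cvgrPdist_le hb; apply/cvgrPdist_le => e e0.
apply: filterS2 (fa e e0) (hb e e0) => t fe he.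
rewrite opp_col_mx add_col_mx; apply: mx_norm_le (ltW e0) _ => i j.
rewrite -(splitK i); case: (fintype.split i) => k /=.
  by rewrite col_mxEu; exact: le_trans (ler_coord_norm _ _ _) fe.
by rewrite col_mxEd; exact: le_trans (ler_coord_norm _ _ _) he.
Qed.

Lemma near_eq_differentiable (V W : normedModType R) (f h : V -> W) x :
  (\forall y \near x, f y = h y) -> differentiable h x -> differentiable f x.
Proof.
move=> fh dh; have fhx := nbhs_singleton fh.
have ch : continuous ('d h x) by exact: diff_continuous.
have E : f \o shift x = cst (f x) + 'd h x +o_ 0 id.
  apply/eqaddoP => e e0; have /diff_locally/eqaddoP/(_ e e0) := dh.
  have sx : y + x @[y --> (0 : V)] --> 0 + x by exact: cvgD cvg_id (cvg_cst x).
  rewrite add0r in sx; have fh0 := sx _ fh; move=> H; near=> y.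
  have fy : f (y + x) = h (y + x) by near: y.
  have : `|(h \o shift x - (cst (h x) + 'd h x)) y| <= e * `|y| by near: y.
  by rewrite !fctE/= fy fhx.
by apply/diff_locallyP; rewrite (diff_unique ch E).
Unshelve. all: by end_near. Qed.

(** If [phi] exceeded [c] at [(y, q0)], it would on a box [A * B]; clustering provides [q] in [B]
    with [O q] in [A] and [phi (O q, q) <= c]. *)
Lemma cluster_le (T P : topologicalType) (O : P -> T) (q0 : P) (y : T)
    (phi : T * P -> R) (c : R) :
  cluster (O @ q0) y -> {for (y, q0), continuous phi} ->
  (\forall q \near q0, phi (O q, q) <= c) -> phi (y, q0) <= c.
Proof.
move=> cly cphi le0; rewrite leNgt; apply/negP => gt0.
have [[A B] /= [nA nB] AB] : \forall z \near (y, q0), c < phi z.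
  exact: (cvgr_gt _ cphi _ gt0).
have FO : (O @ q0) (O @` (B `&` [set q | phi (O q, q) <= c])).
  by apply: filterS2 nB le0 => q Bq cq; exists q.
have [_ [[q [Bq cq] <-] Aq]] := cly _ _ FO nA.
by have := AB (O q, q) (conj Aq Bq); rewrite /= ltNge cq.
Qed.

End matrix_topology.

Section oracle.
Context {R : realType} {n p : nat} (g : game R n p).

Local Notation action := 'cV[R]_(\sum_i dimX g i).
Local Notation leader := 'cV[R]_p.

Lemma deviate_continuous i (w : 'cV[R]_(dimX g i)) :
  continuous (fun x : action => deviate i x w).
Proof.
move=> y; apply/(@cvgrPdist_le _ _ _ (nbhs y)) => e e0.
have : \forall x \near y, `|y - x| <= e.
  by apply/nbhs_normP; exists e => // z; rewrite /ball_/= => /ltW.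
apply: filterS => x xe; apply: mx_norm_le (ltW e0) _ => s k; rewrite ord1 {k}.
have -> : (deviate i y w - deviate i x w) s 0 =
    submxcol (deviate i y w - deviate i x w) (tagnat.sig1 s) (tagnat.sig2 s) 0.
  by rewrite [RHS]mxE tagnat.sig2K.
have sig_norm := ler_coord_norm (y - x) s 0; move: sig_norm.
rewrite -[s in X in X -> _](tagnat.sig2K s).
move: (tagnat.sig1 s) (tagnat.sig2 s) => j r yx.
rewrite submxcolB; have [ij|ne] := eqVneq i j.
  by subst j; rewrite !submxcol_deviate subrr mxE normr0 ltW.
rewrite !submxcol_deviate_neq// -submxcolB mxE.
exact: le_trans yx xe.
Qed.

Context {Pi : set leader} {O : leader -> action} {q0 : leader}.
Context (smooth : smooth_game g Pi) (oracle : equilibrium_oracle Pi O).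
Context (Ppi : Pi° q0).

Lemma near_Pi : \forall q \near q0, Pi° q.
Proof. by apply: open_nbhs_nbhs; split => //; exact: open_interior. Qed.

Lemma oracle_NE q : Pi° q -> is_NE q (O q).
Proof. by move=> /interior_subset Pq; have [] := oracle Pq. Qed.

(** The feasible sets do not depend on the leader, so one deviation [w] is admissible for every [q],
    and its inequality passes to the cluster point. Feasibility is closed as well, so [y] is an
    equilibrium at [q0]. *)
Lemma cluster_oracle y : cluster (O @ q0) y -> y = O q0.
Proof.
move=> cly; apply: (oracle (interior_subset Ppi)).2.
have caff m (M : 'M[R]_(m, _)) s :
    continuous (fun z : (action * leader)%type => (M *m z.1) s 0).
  move=> z; apply: (@continuous_comp _ _ _ (mulmx M \o fst) (fun A : 'cV_m => A s 0)).
    apply: continuous_comp; first exact: cvg_fst.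
    exact: linear_mx_continuous.
  exact: coord_continuous.
have fO q : Pi° q -> forall j, feasible j (submxcol (O q) j).
  by move=> /oracle_NE NEq j; have [] := NEq j.
have Ay : Amx g *m y = bvec g.
  apply/matrixP => s k; rewrite ord1 {k}; apply/eqP; rewrite eq_le.
  have AO q : Pi° q -> (Amx g *m O q) s 0 = bvec g s 0.
    move=> /fO fq; congr (fun_of_matrix _ s 0); apply/mxcolP => j.
    by rewrite block_diag_mul /bvec mxcolK (fq j).1.
  apply/andP; split.
    apply: (@cluster_le _ _ _ O q0 y (fun z => (Amx g *m z.1) s 0)) => //.
      exact: caff.
    by apply: filterS near_Pi => q /AO ->.
  rewrite -lerN2.
  apply: (@cluster_le _ _ _ O q0 y (fun z => - (Amx g *m z.1) s 0)) => //.
    by apply: cvgN; exact: caff.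
  by apply: filterS near_Pi => q /AO ->.
have sy s : slack y s 0 <= 0.
  rewrite !mxE subr_le0.
  have := @cluster_le _ _ _ O q0 y (fun z => (Gmx g *m z.1) s 0) (hvec g s 0) cly.
  rewrite !mxE; apply; first exact: caff.
  by apply: filterS near_Pi => q /fO /(slack_le0 s); rewrite !mxE subr_le0.
have fy := feasibleP Ay sy; move=> i; split => // w fw.
rewrite -subr_le0.
pose phi (z : (action * leader)%type) := objz i z - objz i (deviate i z.1 w, z.2).
apply: (@cluster_le _ _ _ O q0 y phi) => //.
  apply: cvgB.
    exact: differentiable_continuous (differentiable_objz smooth _ _ Ppi).
  apply: (@continuous_comp _ _ _ (fun z => (deviate i z.1 w, z.2)) (objz i)).
    apply: for_continuous_pair; last exact: cvg_snd.
    apply: (@continuous_comp _ _ _ fst (fun x => deviate i x w)).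
      exact: cvg_fst.
    exact: deviate_continuous.
  exact: differentiable_continuous (differentiable_objz smooth _ _ Ppi).
apply: filterS near_Pi => q /oracle_NE /(_ i)[_ /(_ w fw)].
by rewrite /phi /objz subr_le0.
Qed.

Lemma oracle_cvg : bounded_near O (nbhs q0) -> O @ q0 --> O q0.
Proof.
move=> /ex_bound[M bM].
(* [M] covers the values of [O] near [q0]; the [+ 1] makes the ball a neighbourhood of [O q0], as
   [compact_cluster_set1] requires. *)
pose B := Num.max M (`|O q0| + 1).
have FB : (O @ q0) [set x | `|x| <= B].
  by apply: filterS bM => q /= qM; rewrite le_max qM.
have cB := @compact_closed_ball_cV R (\sum_i dimX g i) B.
have PF : ProperFilter (O @ q0) := fmap_proper_filter O (nbhs_pfilter q0).
apply: (@compact_cluster_set1 _ _ _ [set x | `|x| <= B]) => //.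
- have : \forall x \near O q0, `|O q0 - x| <= 1.
    by apply/nbhs_normP; exists 1 => //= z; rewrite /ball_/= => /ltW.
  apply: filterS => x xO /=; rewrite le_max; apply/orP; right.
  by rewrite -lerBlDl (le_trans _ xO)// distrC lerB_dist.
- apply/seteqP; split => [y /cluster_oracle//|_ ->].
  have [y [_ cly]] := cB (O @ q0) PF FB.
  by rewrite -(cluster_oracle cly).
Qed.

Context {lam : 'cV[R]_(\sum_i nineq g i)} {nu : 'cV[R]_(\sum_i neqc g i)}.
Context (kkt : KKT (O q0) lam nu q0) (uM : KKT_mx (O q0) lam q0 \in unitmx).

(* The multipliers l of O q vanish off the active set at O q0, so the KKT matrix
   maps (0, l - lam, v - nu) to (F (O q0) q0 - F (O q) q, 0, 0), which tends
   to 0. *)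
Lemma oracle_KKT_near W : O @ q0 --> O q0 ->
  nbhs (col_mx (O q0) (col_mx lam nu)) W ->
  \forall q \near q0, exists l v, KKT (O q) l v q /\ W (col_mx (O q) (col_mx l v)).
Proof.
move=> cO nW.
pose M := KKT_mx (O q0) lam q0.
(* [T] depends on [O q] and [q] alone, so it is continuous at [q0]; once [T q] is shown to equal
   [(O q, l, v)], this controls multipliers that come from a mere existence statement. *)
pose T q : 'cV[R]_(\sum_i dimX g i + (\sum_i nineq g i + \sum_i neqc g i)) :=
  col_mx (O q) (col_mx lam nu) +
  invmx M *m col_mx (Fmap (O q0) q0 - Fmap (O q) q) 0.
have cT : T @ q0 --> col_mx (O q0) (col_mx lam nu).
  have -> : col_mx (O q0) (col_mx lam nu) = T q0.
    by rewrite /T subrr col_mx0 mulmx0 addr0.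
  have cF : Fmap (O q) q @[q --> q0] --> Fmap (O q0) q0.
    have Sq0 : ([set: action] `*` Pi°) (O q0, q0) by [].
    apply: (@continuous_comp _ _ _ (fun q => (O q, q)) (Fz (g:=g))).
      by apply: for_continuous_pair => //; exact: cvg_id.
    exact: (C1_on_continuous (C1_Fz smooth) Sq0).
  apply: (@cvgD _ _ _ (nbhs q0)).
    by apply: (@cvg_col_mx _ _ (nbhs q0)) => //; exact: cvg_cst.
  apply: (@cvg_comp _ _ _ (fun q => col_mx (Fmap (O q0) q0 - Fmap (O q) q) 0)
    (mulmx (invmx M)) (nbhs q0) (nbhs (col_mx (Fmap (O q0) q0 - Fmap (O q0) q0) 0))).
    apply: (@cvg_col_mx _ _ (nbhs q0)); last exact: cvg_cst.
    by apply: (@cvgB _ _ _ (nbhs q0)) => //; exact: cvg_cst.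
  exact: linear_mx_continuous.
(* Constraints inactive at [O q0] stay inactive at [O q]; complementarity at both points then makes
   [l] and [lam] vanish there. *)
have slack_neq0_near s : \forall q \near q0,
    slack (O q0) s 0 != 0 -> slack (O q) s 0 != 0.
  have [s0|s0] := eqVneq (slack (O q0) s 0) 0.
    exact: filterS near_Pi.
  have slt : slack (O q0) s 0 < 0.
    rewrite lt_neqAle s0; apply: slack_le0 => j.
    by have [] := oracle_NE Ppi j.
  have cs : slack (O q) s 0 @[q --> q0] --> slack (O q0) s 0.
    apply: (@continuous_comp _ _ _ (slack (g:=g) \o O)
      (fun A : 'cV[R]_(\sum_i nineq g i) => A s 0)).
      apply: (@cvgB _ _ _ (nbhs q0)); last exact: cvg_cst.
      apply: (@cvg_comp _ _ _ O (mulmx (Gmx g)) (nbhs q0) (nbhs (O q0)) _ cO).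
      exact: linear_mx_continuous.
    exact: coord_continuous.
  apply: filterS (cvgr_lt _ cs _ slt) => q sq _.
  by rewrite lt_eqF.
have all_slack_near := filter_forall _ slack_neq0_near.
have TW : \forall q \near q0, W (T q) by exact: cT.
near=> q.
have Pq : Pi° q by near: q; exact: near_Pi.
have [l [v kq]] := NE_KKT smooth Pq (oracle_NE Pq).
exists l, v; split => //.
suff <- : T q = col_mx (O q) (col_mx l v) by near: q.
have sq : forall s, slack (O q0) s 0 != 0 -> slack (O q) s 0 != 0.
  by near: q; exact: all_slack_near.
have [F1 _ _] := (KKTE _ _ _ _).1 kkt; have [F2 _ _] := (KKTE _ _ _ _).1 kq.
have E : M *m col_mx 0 (col_mx (l - lam) (v - nu)) =
    col_mx (Fmap (O q0) q0 - Fmap (O q) q) 0.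
  rewrite /M /KKT_mx mul_block_col mul_row_col mul_col_mx mul_block_col.
  rewrite !mulmx0 !mul0mx !addr0 !add0r add_col_mx !add0r -[0 in RHS]col_mx0.
  congr col_mx; last congr col_mx.
    rewrite !mulmxBr; move/eqP: F1; move/eqP: F2.
    rewrite !addr_eq0 => /eqP-> /eqP->.
    by rewrite opprK addrACA -opprD addrC.
  apply/matrixP => s k; rewrite ord1 {k} Diag_mulE [RHS]mxE.
  rewrite -[X in X * _]/(slack (O q0) s 0).
  have [->|s0] := eqVneq (slack (O q0) s 0) 0; first by rewrite mul0r.
  have /eqP := KKT_compl0 s kkt; rewrite mulf_eq0 (negPf s0) orbF => /eqP lam0.
  have /eqP := KKT_compl0 s kq; rewrite mulf_eq0 (negPf (sq s s0)) orbF => /eqP l0.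
  by rewrite [X in _ * X]mxE [X in _ + X]mxE lam0 l0 subrr mulr0.
rewrite /T -E mulKmx// add_col_mx addr0 add_col_mx.
by rewrite ![_ + (_ - _)]addrC !subrK.
Unshelve. all: by end_near. Qed.

End oracle.

(** * The branch coincides with the oracle, and its derivative *)

Lemma eq_mulmx_col (R : realType) m n (A B : 'M[R]_(m, n)) :
  (forall w : 'cV[R]_n, A *m w = B *m w) -> A = B.
Proof.
move=> AB; apply/matrixP => i j.
by have := AB (delta_mx j 0); rewrite -!colE => /matrixP/(_ i 0); rewrite !mxE.
Qed.

Section oracle_derivative.
Context {R : realType} {n p : nat} (g : game R n p).

Local Notation action := 'cV[R]_(\sum_i dimX g i).
Local Notation imult := 'cV[R]_(\sum_i nineq g i).
Local Notation emult := 'cV[R]_(\sum_i neqc g i).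
Local Notation leader := 'cV[R]_p.

Context {Pi : set leader} {O : leader -> action} {q0 : leader}.
Context {lam : imult} {nu : emult}.
Context (smooth : smooth_game g Pi) (oracle : equilibrium_oracle Pi O).
Context (Pq0 : Pi° q0).
Context (kkt : KKT (O q0) lam nu q0) (uM : KKT_mx (O q0) lam q0 \in unitmx).

(** At [q0] each constraint has a positive multiplier or a negative slack. The strict sign persists
    along the branch, and complementarity forces the other factor to be zero, so both families of
    inequalities hold. *)
Lemma convex_KKT_near (xh : leader -> action) (lh : leader -> imult)
    (nh : leader -> emult) :
  own_convex g Pi -> xh @ q0 --> O q0 -> lh @ q0 --> lam ->
  (\forall q \near q0, KKT (xh q) (lh q) (nh q) q) ->
  \forall q \near q0, O q = xh q.
Proof.
move=> cvx cx cl kq.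
have ccoord m (f : leader -> 'cV[R]_m) (a : 'cV[R]_m) s : f @ q0 --> a ->
    f q s 0 @[q --> q0] --> a s 0.
  move=> fa; apply: (@cvg_comp _ _ _ f (fun A : 'cV[R]_m => A s 0) _ _ _ fa).
  exact: coord_continuous.
have cs : (fun q => slack (xh q)) @ q0 --> slack (O q0).
  apply: (@cvgB _ _ _ (nbhs q0)); last exact: cvg_cst.
  apply: (@cvg_comp _ _ _ xh (mulmx (Gmx g)) (nbhs q0) (nbhs (O q0)) _ cx).
  exact: linear_mx_continuous.
have sgn : \forall q \near q0, forall s : 'I_(\sum_i nineq g i),
    0 < lh q s 0 \/ slack (xh q) s 0 < 0.
  apply: (@filter_forall _ _ _ (nbhs q0)) => s.
  have [s0|s0] := eqVneq (slack (O q0) s 0) 0.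
    have l0 : 0 < lam s 0.
      rewrite lt_neqAle eq_sym (strict_complementarity uM s0)/=.
      exact: (NE_mult_ge0 smooth s Pq0 (oracle_NE oracle Pq0) kkt uM).
    by apply: filterS (cvgr_gt _ (ccoord _ _ _ s cl) _ l0) => q; left.
  have slt : slack (O q0) s 0 < 0.
    rewrite lt_neqAle s0; apply: slack_le0 => j.
    by have [] := oracle_NE oracle Pq0 j.
  by apply: filterS (cvgr_lt _ (ccoord _ _ _ s cs) _ slt) => q; right.
near=> q.
have Pq : Pi° q by near: q; exact: near_Pi.
have kqq : KKT (xh q) (lh q) (nh q) q by near: q.
have sq : forall s : 'I_(\sum_i nineq g i),
    0 < lh q s 0 \/ slack (xh q) s 0 < 0 by near: q.
apply/esym/(oracle (interior_subset Pq)).2.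
have compl s := KKT_compl0 s kqq.
apply: (KKT_convex_NE smooth cvx Pq kqq) => s; have /eqP := compl s.
  rewrite mulf_eq0; case: (sq s) => [l0|/ltW//].
  by rewrite gt_eqF//= => /eqP->.
rewrite mulf_eq0; case: (sq s) => [/ltW//|s0].
by rewrite (lt_eqF s0) orbF => /eqP->.
Unshelve. all: by end_near. Qed.

End oracle_derivative.

Theorem proposition1 (R : realType) (n p : nat) (g : game R n p)
    (Pi : set 'cV[R]_p) (O : 'cV[R]_p -> 'cV[R]_(\sum_i dimX g i))
    (pi : 'cV[R]_p)
    (lam : 'cV[R]_(\sum_i nineq g i)) (nu : 'cV[R]_(\sum_i neqc g i)) :
  smooth_game g Pi ->
  equilibrium_oracle Pi O ->
  Pi° pi ->
  KKT (O pi) lam nu pi ->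
  KKT_mx (O pi) lam pi \in unitmx ->
  exists (xh : 'cV[R]_p -> 'cV[R]_(\sum_i dimX g i))
         (lh : 'cV[R]_p -> 'cV[R]_(\sum_i nineq g i))
         (nh : 'cV[R]_p -> 'cV[R]_(\sum_i neqc g i))
         (U : set 'cV[R]_p)
         (W : set ('cV[R]_(\sum_i dimX g i) * 'cV[R]_(\sum_i nineq g i) *
                   'cV[R]_(\sum_i neqc g i))),
    [/\ (* the implicit function theorem holds for the KKT system *)
        [/\ open_nbhs pi U, open_nbhs (O pi, lam, nu) W, U `<=` Pi &
            forall q, U q -> W (xh q, lh q, nh q) /\
              forall x l v, W (x, l, v) ->
                (KKT x l v q <-> [/\ x = xh q, l = lh q & v = nh q])],
        [/\ xh pi = O pi, lh pi = lam & nh pi = nu],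
        [/\ C1_on U xh, C1_on U lh & C1_on U nh],
        (* its derivative is the unique solution of the linear system *)
        forall X L N, sensitivity_system (O pi) lam pi X L N <->
          [/\ X = jac xh pi, L = jac lh pi & N = jac nh pi] &
        (* and it is the derivative of the equilibrium oracle *)
        bounded_near O (nbhs pi) \/ own_convex g Pi ->
        [/\ \forall q \near pi, O q = xh q,
            differentiable O pi &
            forall X L N, sensitivity_system (O pi) lam pi X L N ->
              jac O pi = X]].
Proof.
move=> smooth oracle Ppi kkt uM.
have [||eh [U [W [oU oW ehP eh0 [Ceh Deh]]]]] :=
  @implicit_function R _ _ _ (KKTmap (g:=g)) (col_mx (O pi) (col_mx lam nu)) pi
    (KKT_mx (O pi) lam pi) (open_KKT_domain (g:=g) (Pi:=Pi)) Ppi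
    (C1_KKTmap smooth) _ uM.
- exact/KKT_KKTmap.
- by move=> u; rewrite (derive_KKTmap smooth)// mulmx0 col_mx0 addr0.
have [oUo Upi] := oU.
(* The implicit function theorem works with one stacked vector, the statement with triples; [join]
   is continuous, so the preimage of [W] is open. *)
pose join (t : 'cV[R]_(\sum_i dimX g i) * 'cV[R]_(\sum_i nineq g i) *
    'cV[R]_(\sum_i neqc g i)) := col_mx t.1.1 (col_mx t.1.2 t.2).
have cjoin : continuous join.
  move=> t; apply: cvg_col_mx; last apply: cvg_col_mx; last exact: cvg_snd.
    by apply: (@continuous_comp _ _ _ fst fst); exact: cvg_fst.
  by apply: (@continuous_comp _ _ _ fst snd); [exact: cvg_fst | exact: cvg_snd].
pose xh := usubmx \o eh; pose lh := usubmx \o (dsubmx \o eh).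
pose nh := dsubmx \o (dsubmx \o eh).
have ehE q : col_mx (xh q) (col_mx (lh q) (nh q)) = eh q.
  by rewrite /xh /lh /nh /= !vsubmxK.
have Cxh : C1_on U xh.
  by apply: C1_on_linear_comp Ceh => //; exact: linear_mx_continuous.
have Cdh : C1_on U (dsubmx \o eh).
  by apply: C1_on_linear_comp Ceh => //; exact: linear_mx_continuous.
have Clh : C1_on U lh.
  by apply: C1_on_linear_comp Cdh => //; exact: linear_mx_continuous.
have Cnh : C1_on U nh.
  by apply: C1_on_linear_comp Cdh => //; exact: linear_mx_continuous.
have [xh0 lh0 nh0] : [/\ xh pi = O pi, lh pi = lam & nh pi = nu].
  by rewrite /xh /lh /nh /= eh0 !col_mxKd !col_mxKu.
have W_KKT q x l v : U q -> W (col_mx x (col_mx l v)) ->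
    (KKT x l v q <-> [/\ x = xh q, l = lh q & v = nh q]).
  move=> Uq Wxlv; have [_ _ /(_ _ Wxlv) E] := ehP q Uq.
  rewrite KKT_KKTmap E -ehE; split => [/eq_col_mx[-> /eq_col_mx[-> ->]]//|].
  by move=> [-> -> ->].
have jacE w : col_mx (jac xh pi) (col_mx (jac lh pi) (jac nh pi)) *m w =
    'D_w eh pi.
  have deh := (Ceh pi Upi).1; have ddh := (Cdh pi Upi).1.
  rewrite !mul_col_mx !jac_mul; [|exact: (Cnh pi Upi).1|exact: (Clh pi Upi).1
    |exact: (Cxh pi Upi).1].
  do 5 (rewrite derive_linear_comp//; last exact: linear_mx_continuous).
  by rewrite /= !vsubmxK.
have sens0 : KKT_mx (O pi) lam pi *m
    col_mx (jac xh pi) (col_mx (jac lh pi) (jac nh pi)) =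
    col_mx (- jac (Fmap (O pi)) pi) (col_mx 0 0).
  apply: eq_mulmx_col => w; rewrite -mulmxA jacE.
  have := Deh pi w Upi; rewrite eh0 (derive_KKTmap smooth)// => /eqP.
  rewrite addr_eq0 => /eqP->.
  by rewrite !mul_col_mx !mul0mx col_mx0 opp_col_mx oppr0 mulNmx.
have sens X L N : sensitivity_system (O pi) lam pi X L N <->
    [/\ X = jac xh pi, L = jac lh pi & N = jac nh pi].
  rewrite /sensitivity_system; split=> [|[-> -> ->]//].
  rewrite -sens0 => /(congr1 (mulmx (invmx (KKT_mx (O pi) lam pi)))).
  by rewrite !mulKmx// => /eq_col_mx[-> /eq_col_mx[-> ->]].
exists xh, lh, nh, U, (join @^-1` W); split => //.
- split => //.
  + split; last exact: oW.2.
    by apply: open_comp; [move=> t _; exact: cjoin | exact: oW.1].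
  + by move=> q /ehP[/interior_subset].
  + move=> q Uq; split; last by move=> x l v; exact: W_KKT.
    by rewrite /preimage/= /join/= ehE; have [] := ehP q Uq.
- move=> bdd_cvx.
  have OE : \forall q \near pi, O q = xh q.
    have nearU : \forall q \near pi, U q by exact: open_nbhs_nbhs.
    case: bdd_cvx => [bdd|cvx].
      have := oracle_KKT_near smooth oracle Ppi kkt uM
        (oracle_cvg smooth oracle Ppi bdd) (open_nbhs_nbhs oW).
      apply: filterS2 nearU => q Uq [l [v [kq Wq]]].
      by have [] := (W_KKT _ _ _ _ Uq Wq).1 kq.
    apply: (convex_KKT_near smooth oracle Ppi kkt uM cvx (lh := lh) (nh := nh)).
    + by rewrite -xh0; exact: C1_on_continuous Cxh Upi.
    + by rewrite -lh0; exact: C1_on_continuous Clh Upi.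
    + apply: filterS nearU => q Uq; apply/(W_KKT q) => //.
      by rewrite ehE; have [] := ehP q Uq.
  split => //.
    exact: near_eq_differentiable OE (Cxh pi Upi).1.
  move=> X L N /sens[-> _ _]; apply/matrixP => i j; rewrite !mxE.
  by rewrite (near_eq_derive _ OE).
Qed.
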